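(* Let $p$ be a prime and $\alpha,\beta$ integers different from $1$, and assume that either $p>3$, or $p=3$ and neither $\alpha$ nor $\beta$ is congruent to $7$ modulo $9$. Suppose $v_p(\alpha-1)=v_p(\beta-1)=m>0$ and $\ell\ge 2m$, where $\ell=v_p(\alpha-\beta)$ (with $\ell=\infty$ if $\alpha=\beta$). Then $|G_p|=p^{7m}$, the nilpotency class of $G_p$ is $5$, $o(a)=o(b)=p^{3m}$ and $o(c)=p^{2m}$.
   Context: $G(\alpha,\beta)=\langle A,B\mid A^{[A,B]}=A^{\alpha},\ B^{[B,A]}=B^{\beta}\rangle$ with $[x,y]=x^{-1}y^{-1}xy$, $y^x=x^{-1}yx$, and $C=[A,B]$. The group $G(\alpha,\beta)$ is finite and nilpotent, hence the direct product of its Sylow subgroups; $G_p$ denotes its Sylow $p$-subgroup and $a,b,c$ denote the images of $A,B,C$ under the canonical projection $G(\alpha,\beta)\to G_p$. $v_p$ is the $p$-adic valuation and $o(x)$ the order of $x$. *)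

(* Defs.v *)
From mathcomp Require Import all_boot all_order all_algebra all_fingroup all_solvable.
Set Implicit Arguments. Unset Strict Implicit. Unset Printing Implicit Defensive.
Import GRing.Theory.

Local Open Scope group_scope.

Definition expgi (gT : finGroupType) (x : gT) (z : int) : gT :=
  match z with Posz n => x ^+ n | Negz n => x ^- n.+1 end.

(* The defining relations of G(alpha, beta), with MathComp's conventions
   [~ x, y] = x^-1 * y^-1 * x * y and x ^ y = y^-1 * x * y. *)
Definition Grels (gT : finGroupType) (alpha beta : int) (x y : gT) : Prop :=
  x ^ [~ x, y] = expgi x alpha /\ y ^ [~ y, x] = expgi y beta.

(* (G, x, y) is a presentation of G(alpha, beta): G is generated by x and y,
   these satisfy the relations, and for every finite group and every pair of
   elements u, v satisfying the relations there is a morphism G -> rT sending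
   x |-> u, y |-> v.  Since G(alpha,beta) is finite, this characterizes the
   group G(alpha,beta) together with the images of A and B. *)
Definition is_Gab (gT : finGroupType) (G : {group gT}) (alpha beta : int)
    (x y : gT) : Prop :=
  [/\ G = <<[set x; y]>>, Grels alpha beta x y &
      forall (rT : finGroupType) (u v : rT), Grels alpha beta u v ->
        exists f : {morphism G >-> rT}, f x = u /\ f y = v].

(* Main.v *)
(* Write a, b for alpha, beta, C for [A, B], q = 1/a and [n]_a = 1 + a + ... + a^(n-1).

   The relations give (A^i)^B = C^i A^(a[i]_a), whence G = <B><C><A>.  Right
   multiplication by B permutes the cosets of <B><C>, sending A^i to A^(a[i]_a);
   as powers of a are never 0 modulo r, surjectivity forces every prime r
   dividing the order of A to divide a - 1.  Hence p-parts commute with p'-parts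
   and the Sylow p-subgroup is generated by the p-parts of A and B, which satisfy
   the same relations.

   Computing A^(B^b) in two ways yields C^a A^(-X) = B^(bY) C^b with
   X = a^a - [a]_a and Y = b^b - [b]_b; under the hypotheses X and Y have
   valuation exactly 2m.  Conjugating this relation by C and by B bounds the
   orders of A, B, C and gives A^(p^2m) in <B>, hence |G_p| <= p^(7m) and class
   at most 5.

   For the lower bound, G acts on the normal forms A^i C^k B^j modulo
   A^(p^2m) B^(p^2m) = 1: A translates i, C multiplies i by q, and B^-1 is the
   q-exponential i |-> [i]_q.  The only nontrivial point is that this is an
   action, i.e. that the b-th iterate of [.]_q agrees with C[.]_q C^-1 to the
   required precision. *)

Require Import Defs.
From mathcomp Require Import all_boot all_order all_algebra all_fingroup all_solvable.
From mathcomp Require Import zify ring.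
Import GRing.Theory.
Set Implicit Arguments. Unset Strict Implicit. Unset Printing Implicit Defensive.

(** * Arithmetic of q-numbers *)

(* The q-number [n]_a = (a ^ n - 1) / (a - 1). *)
Definition brk (a n : nat) : nat := \sum_(i < n) a ^ i.

Lemma brk0 a : brk a 0 = 0. Proof. exact: big_ord0. Qed.

Lemma brkS a n : brk a n.+1 = brk a n + a ^ n.
Proof. by rewrite /brk big_ord_recr. Qed.

Lemma brkSl a n : brk a n.+1 = 1 + a * brk a n.
Proof.
rewrite /brk big_ord_recl expn0 big_distrr /=; congr (_ + _).
by apply: eq_bigr => i _; rewrite expnS.
Qed.

Lemma brkD a n k : brk a (n + k) = brk a n + a ^ n * brk a k.
Proof.
elim: k => [|k IH]; first by rewrite addn0 brk0 muln0 addn0.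
by rewrite addnS !brkS IH mulnDr expnD addnA.
Qed.

Lemma brkM a n k : brk a (n * k) = brk a n * brk (a ^ n) k.
Proof.
elim: k => [|k IH]; first by rewrite muln0 !brk0 muln0.
by rewrite mulnS addnC brkD IH brkS -expnM mulnDr (mulnC (brk a n) (a ^ _)).
Qed.

Lemma brk_geo u n : u.+1 ^ n = 1 + u * brk u.+1 n.
Proof.
elim: n => [|n IH]; first by rewrite brk0 muln0.
rewrite brkS expnS IH; ring.
Qed.

Lemma expn_Taylor u n :
  exists e, u.+1 ^ n = 1 + n * u + 'C(n, 2) * u ^ 2 + u ^ 3 * e.
Proof.
elim: n => [|n [e IH]]; first by exists 0; rewrite bin0n !mul0n muln0.
exists ('C(n, 2) + e * u.+1); rewrite expnS IH binS bin1; ring.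
Qed.

Lemma brk_Taylor u n :
  exists e, brk u.+1 n = n + 'C(n, 2) * u + 'C(n, 3) * u ^ 2 + u ^ 3 * e.
Proof.
elim: n => [|n [e IH]]; first by exists 0; rewrite brk0 !bin0n !mul0n muln0.
have [f Hf] := expn_Taylor u n.
exists (e + f); rewrite brkS IH Hf !binS bin1; ring.
Qed.

Lemma bin2_odd p : odd p -> 'C(p, 2) = p * p./2.
Proof.
by move=> op; rewrite bin2 -{2}[p]odd_double_half op add1n /= -doubleMr doubleK.
Qed.

(** Induction on [s], with a = u + 1: [n' p^s p]_a = [n' p^s]_a [p]_A for A = a^(n' p^s), so it
    suffices that [p]_A is p modulo p^(m+1). The linear term in A - 1 gains a factor p from 'C(p,
    2), as p is odd; in the higher terms (A - 1)^2 supplies p^(2m), and m > 0. *)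
Lemma brk_pow_dvd p m s u n : odd p -> (0 < m)%N -> p ^ m %| u -> p ^ s %| n ->
  exists c, brk u.+1 n = n + p ^ (m + s) * c.
Proof.
move=> op m0 /dvdnP[t ->].
elim: s n => [|s IH] n.
  move=> _; have [e ->] := brk_Taylor (t * p ^ m) n; rewrite addn0.
  by exists ('C(n, 2) * t + 'C(n, 3) * t ^ 2 * p ^ m + t ^ 3 * p ^ m * p ^ m * e); ring.
case/dvdnP=> n' ->.
have [c Hc] := IH (n' * p ^ s) (dvdn_mull _ (dvdnn _)).
set b := brk _ _ in Hc.
have [e He] := brk_Taylor (t * p ^ m * b) p.
set K := 'C(p, 3) + t * p ^ m * b * e.
exists (c + (n' + p ^ m * c) * (p./2 * t * b + t ^ 2 * p ^ m.-1 * b ^ 2 * K)).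
have -> : n' * p ^ s.+1 = n' * p ^ s * p by rewrite expnS; ring.
rewrite brkM brk_geo -/b add1n He bin2_odd // /K.
have -> : p ^ (m + s.+1) = p ^ m * p ^ s * p by rewrite addnS expnS expnD; ring.
rewrite expnD in Hc.
have Pm : p ^ m = p * p ^ m.-1 by rewrite -expnS prednK.
move: Hc Pm; move: b {He K} (p ^ m) (p ^ s) (p ^ m.-1) => b P Q P' Hc Pm.
have {}Hc : b = Q * (n' + P * c) by rewrite Hc; ring.
transitivity (n' * Q * p + P * Q * c * p + (n' + P * c) * Q * (p * p./2 * t * b * P) +
   (n' + P * c) * Q * (t ^ 2 * b ^ 2 * P * (p * P') * ('C(p, 3) + t * P * b * e))).
  by rewrite -Pm {1}Hc; ring.
ring.
Qed.

(** A prime r is split off: [n' r]_a = [n']_a [r]_A with A = a^n'. Since A is 1 modulo r, [r]_A is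
    congruent to r, hence to 0. *)
Lemma dvdn_brk u n : (forall r, prime r -> r %| n -> r %| u) -> n %| brk u.+1 n.
Proof.
elim/ltn_ind: n => n IH Hn.
case: (ltngtP n 1) => [|n1|->]; last exact: dvd1n.
  by case: n {IH Hn} => // _; rewrite brk0.
have pr := pdiv_prime n1; have /dvdnP[n' En] := pdiv_dvd n.
set r := pdiv n in pr En; rewrite En brkM dvdn_mul //.
  apply: IH => [|s ps sn]; last by apply: Hn => //; rewrite En dvdn_mulr.
  by rewrite En ltn_Pmulr ?prime_gt1 //; case: n' En n1 => // ->.
rewrite brk_geo add1n; have ru : r %| u by apply: Hn => //; rewrite En dvdn_mull.
have [e ->] := brk_Taylor (u * brk u.+1 n') r.
have /dvdnP[k ->] : r %| u * brk u.+1 n' by rewrite dvdn_mulr.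
by apply/dvdnP; exists (1 + 'C(r, 2) * k + 'C(r, 3) * k ^ 2 * r + k ^ 3 * r * r * e); ring.
Qed.

(** If n is the order of z and z^c = z^a with a = u + 1, this says that c^n centralizes z. *)
Lemma expn_mod_radical u n : (forall r, prime r -> r %| n -> r %| u) ->
  u.+1 ^ n = 1 %[mod n].
Proof.
move=> Hn; rewrite brk_geo; have /dvdnP[k ->] := dvdn_brk Hn.
by rewrite addnC mulnA modnMDl.
Qed.

(* 6 (a^a - [a]_a) is u^2 (3 + u) up to multiples of u^3, of 3 u^3 if p = 3.  For
   p = 3 the factor 3 + u is divisible by 9 exactly when a = 7 mod 9. *)
Lemma expn_sub_brk p m u t : odd p -> prime p -> (0 < m)%N -> u = p ^ m * t ->
  ~~ (p %| t) -> (p = 3 -> u.+1 != 7 %[mod 9]) ->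
  exists2 k, u.+1 ^ u.+1 = brk u.+1 u.+1 + p ^ (2 * m) * k & ~~ (p %| k).
Proof.
move=> op pp m0 Eu ptN p3.
have t0 : (0 < t)%N by case: t ptN {Eu} => //; rewrite dvdn0.
have u0 : (0 < u)%N by rewrite Eu muln_gt0 expn_gt0 prime_gt0.
have [X EX] : exists X, u.+1 ^ u.+1 = brk u.+1 u.+1 + X.
  by exists (1 + u.-1 * brk u.+1 u.+1); rewrite brk_geo -{1}(prednK u0); ring.
have HX : exists e f, 6 * X + u ^ 5 + 6 * u ^ 3 * f = 3 * u ^ 2 + u ^ 3 + 3 * u ^ 4 + 6 * u ^ 3 * e.
  have [e He] := expn_Taylor u u.+1; have [f Hf] := brk_Taylor u u.+1.
  exists e, f; rewrite {}Hf {}He in EX.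
  have C2 : 'C(u.+1, 2) * 2 = u * u.+1.
    by have := bin_ffact u.+1 2; rewrite !ffactnS ffactn0 (_ : 2`! = 2) //=; nia.
  have C3 : 'C(u.+1, 3) * 6 + u * u.+1 = u.+1 * u ^ 2.
    by have := bin_ffact u.+1 3; rewrite !ffactnS ffactn0 (_ : 3`! = 6) //=; nia.
  move: EX C2 C3; move: 'C(u.+1, 2) 'C(u.+1, 3) => c2 c3; rewrite mulnS mulSn.
  nia.
case: HX => e [f HX].
set P := p ^ m in Eu; have -> : p ^ (2 * m) = P ^ 2 by rewrite mulnC expnM.
have pu : p %| u by rewrite Eu /P -(prednK m0) expnS -mulnA dvdn_mulr.
have P0 : (0 < P ^ 2)%N by rewrite !expn_gt0 prime_gt0.
have [p_3|pn3] := eqVneq p 3; last first.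
  have cop6 : coprime p 6.
    by rewrite prime_coprime // -[6]/(2 * 3) Euclid_dvdM // !dvdn_prime2 //
       negb_or pn3 andbT; apply: contraTneq op => ->.
  have /dvdnP[k EXk] : P ^ 2 %| X.
    rewrite -(@Gauss_dvdr _ 6); last by rewrite !coprimeXl.
    have : P ^ 2 %| 6 * X + (u ^ 5 + 6 * u ^ 3 * f).
      rewrite addnA HX Eu; apply/dvdnP.
      by exists (t ^ 2 * (3 + P * t + 3 * (P * t) ^ 2 + 6 * (P * t) * e)); ring.
    rewrite dvdn_addl // Eu; apply/dvdnP.
    by exists (t ^ 2 * ((P * t) ^ 3 + 6 * (P * t) * f)); ring.
  exists k; first by rewrite EX EXk mulnC.
  have E6 : 6 * k + t ^ 2 * (u ^ 3 + 6 * u * f) = t ^ 2 * 3 + t ^ 2 * (u + 3 * u ^ 2 + 6 * u * e).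
    apply/eqP; rewrite -(eqn_pmul2l P0); apply/eqP.
    rewrite EXk Eu in HX; rewrite Eu.
    by transitivity (6 * (k * P ^ 2) + (P * t) ^ 5 + 6 * (P * t) ^ 3 * f);
       [ring | rewrite HX; ring].
  apply/negP => pk; have : p %| t ^ 2 * 3.
    have : p %| t ^ 2 * 3 + t ^ 2 * (u + 3 * u ^ 2 + 6 * u * e).
      by rewrite -E6; case/dvdnP: pk => k' ->; case/dvdnP: pu => u' ->; apply/dvdnP;
         exists (6 * k' + t ^ 2 * (u' * (u' * p) ^ 2 + 6 * u' * f)); ring.
    rewrite dvdn_addl //; case/dvdnP: pu => u' ->; apply/dvdnP.
    by exists (t ^ 2 * (u' + 3 * u' * u' * p + 6 * u' * e)); ring.
  by rewrite Euclid_dvdM // Euclid_dvdX // (negbTE ptN) /= dvdn_prime2 // (negbTE pn3).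
have cop2 : coprime (P ^ 2) 2 by rewrite !coprimeXl // coprimen2.
(* For p = 3 the identity is divided by 3 through u = 3 v, so that only the factor 2, prime to 3,
   remains to be cancelled. *)
case/dvdnP: pu => v Ev; move/(_ p_3) in p3; rewrite {}p_3 in pp op ptN Ev *.
have HX2 : 2 * X + u ^ 4 * v + 6 * u ^ 2 * v * f = u ^ 2 * (1 + v + 3 * u * v + 6 * v * e).
  apply/eqP; rewrite -(@eqn_pmul2l 3) //; apply/eqP; rewrite Ev in HX *.
  by transitivity (6 * X + (v * 3) ^ 5 + 6 * (v * 3) ^ 3 * f);
       [ring | rewrite HX; ring].
have /dvdnP[k EXk] : P ^ 2 %| X.
  rewrite -(@Gauss_dvdr _ 2); last exact: cop2.
  have : P ^ 2 %| 2 * X + (u ^ 4 * v + 6 * u ^ 2 * v * f).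
    by rewrite addnA HX2 {1}Eu; apply/dvdnP; exists (t ^ 2 * (1 + v + 3 * u * v + 6 * v * e)); ring.
  rewrite dvdn_addl // Eu; apply/dvdnP.
  by exists (t ^ 2 * ((P * t) ^ 2 * v + 6 * v * f)); ring.
exists k; first by rewrite EX EXk mulnC.
have E2 : 2 * k + t ^ 2 * (u ^ 2 * v + 6 * v * f) = t ^ 2 * (1 + v + 3 * u * v + 6 * v * e).
  apply/eqP; rewrite -(eqn_pmul2l P0); apply/eqP.
  rewrite EXk {2 4}Eu in HX2; rewrite Eu in HX2 *.
  by transitivity (2 * (k * P ^ 2) + (P * t) ^ 4 * v + 6 * (P * t) ^ 2 * v * f);
       [ring | rewrite HX2; ring].
apply/negP => pk; have : 3 %| t ^ 2 * (1 + v).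
  have : 3 %| t ^ 2 * (1 + v) + 3 * t ^ 2 * (u * v + 2 * v * e).
    have -> : t ^ 2 * (1 + v) + 3 * t ^ 2 * (u * v + 2 * v * e) = t ^ 2 * (1 + v + 3 * u * v + 6 * v * e) by ring.
    rewrite -E2; case/dvdnP: pk => k' ->; rewrite Ev; apply/dvdnP.
    by exists (2 * k' + t ^ 2 * (v * 3 * v * v + 2 * v * f)); ring.
  by rewrite dvdn_addl // -mulnA dvdn_mulr.
(* As 3 does not divide t, it divides 1 + v; with u = 3 v this makes u + 1 congruent to 7 modulo
   9. *)
rewrite Euclid_dvdM // Euclid_dvdX // (negbTE ptN) /= => v2.
by case/negP: p3; apply/eqP; lia.
Qed.

Lemma bin3D n k :
  'C(n + k, 3) = ('C(n, 3) + 'C(n, 2) * k + n * 'C(k, 2) + 'C(k, 3))%N.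
Proof. by rewrite -binomial.Vandermonde !big_ord_recr big_ord0 /= !bin0 !bin1; ring. Qed.

(** Since 3 'C(n, 3) is a multiple of n, at most one factor 3 is lost, and 2m - 1 >= m. *)
Lemma dvdn_bin3 p m n : prime p -> 0 < m -> p ^ (2 * m) %| n -> p ^ m %| 'C(n, 3).
Proof.
move=> pp m0 pn; have : p ^ (2 * m) %| 3 * 'C(n, 3) by rewrite -mul_bin_diag dvdn_mulr.
have [->|p3] := eqVneq p 3.
  have -> : 2 * m = (m.-1 + m).+1 by lia.
  by rewrite expnS dvdn_pmul2l // expnD; apply/dvdn_trans/dvdn_mull.
rewrite Gauss_dvdr; last by rewrite coprimeXl // prime_coprime // dvdn_prime2.
by apply: dvdn_trans; rewrite dvdn_exp2l //; lia.
Qed.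

Local Open Scope group_scope.

(** * The Macdonald relations in a finite group *)

(** Natural exponents replace the integers alpha and beta, which matter only modulo the orders of
    the elements. *)
Definition Mac (gT : finGroupType) (a b : nat) (x y : gT) : Prop :=
  x ^ [~ x, y] = x ^+ a /\ y ^ [~ y, x] = y ^+ b.

Lemma Mac_sym (gT : finGroupType) a b (x y : gT) : Mac a b x y -> Mac b a y x.
Proof. by case. Qed.

Section ConjPower.
Variables (gT : finGroupType) (z c : gT) (a : nat).
Hypothesis zc : z ^ c = z ^+ a.

Lemma conjg_expn k n : (z ^+ k) ^ (c ^+ n) = z ^+ (k * a ^ n).
Proof.
elim: n k => [|n IH] k; first by rewrite conjg1 muln1.
by rewrite expgS conjgM conjXg zc -expgM IH expnS mulnCA mulnA.
Qed.

Lemma expg_mul_conj n : (z * c) ^+ n = c ^+ n * z ^+ (a * brk a n).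
Proof.
elim: n => [|n IH]; first by rewrite brk0 muln0 mulg1.
rewrite expgSr IH mulgA -(mulgA _ _ z) -expgSr -mulgA [_ * c]conjgC conjXg zc -expgM.
by rewrite mulgA -expgSr brkSl add1n.
Qed.

End ConjPower.

Section Factorization.
Variables (gT : finGroupType) (a b : nat) (x y : gT).
Hypothesis Mxy : Mac a b x y.
Local Notation c := [~ x, y].

Lemma Mac_conjx : x ^ c = x ^+ a. Proof. by case: Mxy. Qed.

Lemma Mac_conjy : y ^ c^-1 = y ^+ b. Proof. by rewrite invg_comm; case: Mxy. Qed.

Lemma Mac_conjxn k n : (x ^+ k) ^ (c ^+ n) = x ^+ (k * a ^ n).
Proof. exact/conjg_expn/Mac_conjx. Qed.

Lemma Mac_conjyn k n : (y ^+ k) ^ (c ^- n) = y ^+ (k * b ^ n).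
Proof. by rewrite -expgVn; apply/conjg_expn/Mac_conjy. Qed.

Lemma Mac_expx n : (x ^+ n) ^ y = c ^+ n * x ^+ (a * brk a n).
Proof. by rewrite conjXg conjg_mulR; apply/expg_mul_conj/Mac_conjx. Qed.

Lemma Mac_expy n : (y ^+ n) ^ x = c ^- n * y ^+ (b * brk b n).
Proof.
by rewrite conjXg conjg_mulR -invg_comm -expgVn; apply/expg_mul_conj/Mac_conjy.
Qed.

Lemma Mac_norm_cycle_x : <[c]> \subset 'N(<[x]>).
Proof. by rewrite norms_cycle Mac_conjx mem_cycle. Qed.

Lemma Mac_norm_cycle_y : <[c]> \subset 'N(<[y]>).
Proof. by rewrite -cycleV norms_cycle Mac_conjy mem_cycle. Qed.

(** By x^i y = y c^i x^(a [i]_a), and because c normalizes <y>, the product is stable under right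
    multiplication by both generators. *)
Lemma Mac_factor : <<[set x; y]>> = <[y]> * <[c]> * <[x]>.
Proof.
set T := <[y]> * <[c]> * <[x]>.
(* If T g is contained in T, they are equal by cardinality, so [g] lies in the stabilizer of [T],
   which is a group. *)
have fixT g : {in T, forall h, h * g \in T} -> g \in 'C[T | 'Rs].
  move=> Tg; apply/astab1P; apply/eqP.
  rewrite /= rcosetE eqEcard card_rcoset leqnn andbT; apply/subsetP=> _ /rcosetP[h Th ->].
  exact: Tg.
apply/eqP; rewrite eqEsubset; apply/andP; split; last first.
  have xG : x \in <<[set x; y]>> by rewrite mem_gen // !inE eqxx.
  have yG : y \in <<[set x; y]>> by rewrite mem_gen // !inE eqxx orbT.
  by rewrite !mul_subG // cycle_subG // groupR.
have /subsetP sGT : <<[set x; y]>> \subset 'C[T | 'Rs].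
  rewrite gen_subG; apply/subsetP=> _ /set2P[]->; apply: fixT.
    by move=> _ /mulsgP[u v Tu xv ->]; rewrite -mulgA mem_mulg // groupM // cycle_id.
  move=> _ /mulsgP[_ _ /mulsgP[u _ uy /cycleP[k ->] ->] /cycleP[i ->] ->].
  rewrite -!mulgA [_ * y]conjgC Mac_expx.
  rewrite (_ : _ * _ = u * (y ^ (c ^- k)) * (c ^+ (k + i)) * x ^+ (a * brk a i)).
    rewrite !mem_mulg ?mem_cycle // -[y]expg1 Mac_conjyn groupM // mem_cycle //.
  by rewrite expgD /conjg invgK !mulgA mulgKV.
apply/subsetP=> g /sGT/astab1P/= <-; rewrite rcosetE; apply/rcosetP; exists 1; last by rewrite mul1g.
by rewrite -[1]mulg1 -{1}[1]mulg1 !mem_mulg ?group1.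
Qed.

(** By [Mac_factor], the order of the group divides the product of the orders of y, c and x. *)
Lemma Mac_pgroup pi : pi.-elt x -> pi.-elt y -> pi.-elt c -> pi.-group <<[set x; y]>>.
Proof.
move=> px py pc; rewrite Mac_factor -mulgA.
have cx := norm_joinEl Mac_norm_cycle_x.
rewrite -cx /pgroup.
have := mul_cardG <[y]> (<[c]> <*> <[x]>).
have pcx : pi.-group (<[c]> <*> <[x]>) by rewrite cx pgroupM; apply/andP.
move=> E; have : pi.-nat (#|<[y]>| * #|<[c]> <*> <[x]>|)%N by rewrite pnatM; apply/andP.
by rewrite E pnatM => /andP[].
Qed.

Lemma Mac_centx z : z \in <[x]> -> z \in <[y]> -> z \in 'C(<<[set x; y]>>).
Proof.
move=> zx zy; rewrite cent_gen; apply/centP=> _ /set2P[]->.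
  by case/cycleP: zx => i ->; apply/commute_sym/commuteX.
by case/cycleP: zy => i ->; apply/commute_sym/commuteX.
Qed.

(** A central z equals z^c, which is z^a when z is a power of x. *)
Lemma Mac_cent_expn u z : a = u.+1 ->
  z \in <[x]> -> z \in 'C(<<[set x; y]>>) -> z ^+ u = 1.
Proof.
move=> au /cycleP[i ->] cz.
have cG : c \in <<[set x; y]>> by rewrite groupR // mem_gen // !inE eqxx ?orbT.
have := conjg_fixP (introT commgP (centP cz c cG)); rewrite conjXg Mac_conjx => E.
by apply: (mulIg (x ^+ i)); rewrite mul1g -expgSr -au -[in RHS]E -!expgM mulnC.
Qed.

(* The cosets of <y><c> are represented by powers of x and y permutes them by
   x^i -> x^(a [i]_a).  When r does not divide a - 1, the image of the
   exponential [.]_a misses a residue modulo r. *)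
Lemma Mac_prime_order_x u r : a = u.+1 -> prime r -> r %| #[x] -> r %| u.
Proof.
move=> au pr rx; apply: contraT => ru.
(* x^a is conjugate to x, so a is prime to the order of x. *)
have copa : coprime #[x] a.
  have := orderXgcd x a; rewrite -Mac_conjx orderJ => E.
  rewrite /coprime -(eqn_pmul2l (order_gt0 x)) muln1.
  by rewrite {1}E divnK ?dvdn_gcdl.
have {copa}ra0 : ~~ (r %| a).
  by apply: contraL copa => rda; apply/negP => /(coprime_dvdl rx); rewrite prime_coprime // rda.
(* [j] is the missed residue: u (a [i]_a) + a = a^(i+1) is never 0 modulo r, whereas u j + a is. *)
have [j rj] : exists j, r %| u * j + a.
  have cop : coprime u r by rewrite coprime_sym prime_coprime.
  have /eqP := chinese_modl cop 0 (r.-1 * a); rewrite mod0n -/(_ %| _).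
  case/dvdnP=> j Ej; exists j; rewrite mulnC -Ej /dvdn -modnDml chinese_modr // modnDml.
  by rewrite -mulSnr prednK ?prime_gt0 // modnMr.
have xG : x \in <<[set x; y]>> by rewrite mem_gen // !inE eqxx.
have yG : y \in <<[set x; y]>> by rewrite mem_gen // !inE eqxx orbT.
have : x ^+ j * y^-1 \in <<[set x; y]>> by rewrite groupM ?groupV ?groupX.
rewrite Mac_factor; case/mulsgP=> h _ Hh /cycleP[i ->] /(canRL (mulgKV _)) Ej.
(* [N] stands for j - a [i]_a, the factor [#[x].-1] playing the role of -1 in the exponent of x. *)
pose N := (j + #[x].-1 * (a * brk a i))%N.
have : x ^+ N \in <[y]> * <[c]>.
  have -> : x ^+ N = h * (y * c ^+ i).
    rewrite /N expgD Ej -!mulgA [x ^+ i * _]mulgA [_ * y]conjgC Mac_expx -!mulgA -expgD.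
    by rewrite -mulSn prednK // expgM expg_order expg1n mulg1.
  rewrite -(norm_joinEr Mac_norm_cycle_y) in Hh *; rewrite !groupM //.
    by rewrite mem_gen // inE cycle_id.
  by rewrite groupX // mem_gen // inE cycle_id orbT.
case/mulsgP=> v _ vy /cycleP[k ->] EN.
(* Conjugating x^N = v c^k by c and dividing by the original equation eliminates c: x^(N u) is v^c
   v^-1, which lies in <y>. *)
have zy : x ^+ (N * u) \in <[y]>.
  have : v ^ c * v^-1 \in <[y]>.
    by rewrite groupM ?groupV // memJ_norm // (subsetP Mac_norm_cycle_y) ?cycle_id.
  have -> : v = x ^+ N * c ^- k by rewrite EN mulgK.
  have Ec : (c ^- k) ^ c = c ^- k by rewrite conjVg conjXg conjgE mulKg.
  rewrite conjMg conjXg Mac_conjx Ec -expgM invMg invgK mulgA mulgKV.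
  by rewrite au mulSn addnC expgD mulgK mulnC.
have := Mac_cent_expn au (mem_cycle _ _) (Mac_centx (mem_cycle _ _) zy).
rewrite -expgM => /eqP; rewrite -order_dvdn => /(dvdn_trans rx).
rewrite !Euclid_dvdM // (negbTE ru) !orbF => rN; case/negP: ra0.
have : r %| u * N + a ^ i.+1.
  have -> : (u * N + a ^ i.+1 = u * j + a + u * #[x] * (a * brk a i))%N.
    by rewrite /N expnS {4}au brk_geo -au -[#[x] in RHS]prednK //; ring.
  by rewrite dvdn_add // dvdn_mulr // dvdn_mull.
by rewrite dvdn_addr ?dvdn_mull // Euclid_dvdX // => /andP[].
Qed.
End Factorization.

(** * Splitting off the p-part *)

(** n is prime to the order of the pi-part of g, so this part is a power of its own n-th power,
    hence of g^n. *)
Lemma commute_constt_expg (gT : finGroupType) pi (g h : gT) n :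
  commute (g ^+ n) h -> pi^'.-nat n -> commute g.`_pi h.
Proof.
move=> gh pin; have cop : coprime #|<[g.`_pi]>| n.
  by rewrite (pnat_coprime _ pin) // -/(_.-elt _) p_elt_constt.
rewrite -(expgK cop (cycle_id _)); apply/commute_sym/commuteX.
have /cycleP[j ->] := cycle_constt pi g; rewrite -expgM mulnC expgM.
exact/commuteX/commute_sym.
Qed.

(** Let x' be the pi'-part of x and n its order. Every prime dividing n divides a - 1, so a^n is 1
    modulo n and c^n centralizes x'; as n is a pi'-number, so does the pi-part of c. *)
Lemma Mac_commute_constt_x (gT : finGroupType) u b (x y : gT) pi :
  Mac u.+1 b x y -> commute [~ x, y].`_pi x.`_pi^'.
Proof.
move=> Mxy; set x' := x.`_pi^'; apply: (@commute_constt_expg _ _ _ _ #[x']); last exact: p_elt_constt.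
apply/commute_sym/commgP/conjg_fixP.
have /cycleP[i Ei] := cycle_constt pi^' x; rewrite -/x' in Ei.
rewrite {1}Ei (Mac_conjxn Mxy) expgM -Ei -[RHS]expg1; apply/eqP.
rewrite eq_expg_mod_order; apply/eqP/expn_mod_radical => r pr rx.
apply: (Mac_prime_order_x Mxy) => //; apply: dvdn_trans rx _.
by rewrite Ei orderXdvd.
Qed.

Lemma Mac_commute_constt_y (gT : finGroupType) a v (x y : gT) pi :
  Mac a v.+1 x y -> commute [~ x, y].`_pi y.`_pi^'.
Proof.
move/Mac_sym/(@Mac_commute_constt_x _ _ _ _ _ pi).
rewrite -invg_comm consttV => /commute_sym/commuteV; rewrite invgK.
exact: commute_sym.
Qed.

(** x^y = x c splits into commuting factors, the products of the pi-parts and of the pi'-parts of x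
    and c. Each product is a pi- or pi'-element because the part of c normalizes the subgroup
    generated by the part of x. *)
Lemma Mac_constt_conjx (gT : finGroupType) u b (x y : gT) pi :
  Mac u.+1 b x y -> x.`_pi ^ y = x.`_pi * [~ x, y].`_pi.
Proof.
move=> Mxy; set c := [~ x, y].
have cx := Mac_commute_constt_x pi Mxy.
have := Mac_commute_constt_x pi^' Mxy; rewrite consttNK => cx'.
rewrite -consttJ conjg_mulR -/c -{1}(consttC pi x) -{1}(consttC pi c).
have -> : x.`_pi * x.`_pi^' * (c.`_pi * c.`_pi^') = x.`_pi * c.`_pi * (x.`_pi^' * c.`_pi^').
  by rewrite -!mulgA; congr (_ * _); rewrite !mulgA cx.
have nxc pi1 : <[c.`_pi1]> \subset 'N(<[x.`_pi1]>).
  rewrite norms_cycle; have /cycleP[i ->] := cycle_constt pi1 c.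
  have /cycleP[j Ej] := cycle_constt pi1 x.
  by rewrite {1}Ej (Mac_conjxn Mxy) expgM -Ej mem_cycle.
have pxc pi1 : pi1.-elt (x.`_pi1 * c.`_pi1).
  have pG : pi1.-group (<[x.`_pi1]> <*> <[c.`_pi1]>).
    by rewrite (norm_joinEr (nxc _)) pgroupM; apply/andP; split; apply: p_elt_constt.
  by apply: (mem_p_elt pG); rewrite groupM // mem_gen // inE cycle_id ?orbT.
have cc (g : gT) : commute g.`_pi g.`_pi^'.
  have /cycleP[i ->] := cycle_constt pi g; have /cycleP[j ->] := cycle_constt pi^' g.
  exact: commuteX2.
rewrite consttM; last first.
  apply: commuteM; apply/commute_sym; apply: commuteM.
  - exact: (commute_sym (cc x)).
  - exact: (commute_sym cx).
  - exact: cx'.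
  - exact: (commute_sym (cc c)).
by rewrite (constt_p_elt (pxc pi)) (constt1P (pxc pi^')) mulg1.
Qed.

(** Put s for the pi-part of x, t for the pi'-part of y, and d for the pi-part of c. Conjugation by
    y sends s to s d and s^t to s^t d, since t commutes with y and d; the quotient is therefore
    fixed. *)
Lemma Mac_constt_conj_fixed (gT : finGroupType) u v (x y : gT) pi :
  Mac u.+1 v.+1 x y -> commute (x.`_pi ^ y.`_pi^' * (x.`_pi)^-1) y.
Proof.
move=> Mxy; set t := y.`_pi^'.
have ty : commute t y.
  by rewrite /t; have /cycleP[j ->] := cycle_constt pi^' y; apply/commute_sym/commuteX.
have tc : [~ x, y].`_pi ^ t = [~ x, y].`_pi.
  by apply/conjg_fixP/commgP; apply: Mac_commute_constt_y Mxy.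
apply/commgP/conjg_fixP; rewrite conjMg conjVg -conjgM ty conjgM.
by rewrite !(Mac_constt_conjx pi Mxy) conjMg tc invMg mulgA mulgK.
Qed.

(** f = s^t s^-1 commutes with t; by symmetry t^s t^-1, which turns out to be f^-1, commutes with s.
    Then the order of f divides those of s and of t, which are coprime, so f = 1. *)
Lemma Mac_commute_constt (gT : finGroupType) u v (x y : gT) pi :
  Mac u.+1 v.+1 x y -> commute x.`_pi y.`_pi^'.
Proof.
move=> Mxy; set s := x.`_pi; set t := y.`_pi^'.
pose f := s ^ t * s^-1.
have fy : commute f y := Mac_constt_conj_fixed pi Mxy.
have fx : commute (t ^ s * t^-1) x.
  by have := Mac_constt_conj_fixed pi^' (Mac_sym Mxy); rewrite consttNK.
have sx (g : gT) : commute g x -> commute g s.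
  by rewrite /s; have /cycleP[j ->] := cycle_constt pi x; apply: commuteX.
have ty (g : gT) : commute g y -> commute g t.
  by rewrite /t; have /cycleP[j ->] := cycle_constt pi^' y; apply: commuteX.
have fV : t ^ s * t^-1 = f^-1.
  have : (t ^ s * t^-1) ^ s^-1 = f^-1 ^ t^-1.
    by rewrite /f !conjgE !invMg !invgK !mulgA mulgV mul1g mulgK.
  rewrite (conjg_fixP _) => [->|]; last exact/commgP/commuteV/sx.
  by apply/conjg_fixP/commgP; apply: commuteV; apply/commute_sym/commuteV/commute_sym/ty.
have {}fx : commute f s by rewrite -[f]invgK -fV; apply/commute_sym/commuteV/commute_sym/sx.
have {}fy := ty _ fy.
have fs : f ^+ #[s] = 1.
  have : (s ^ t) ^+ #[s] = 1 by rewrite -(orderJ s t) expg_order.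
  by rewrite -[s ^ t](mulgKV s) -/f expgMn // expg_order mulg1.
have ft : f ^+ #[t] = 1.
  have : (t ^ s^-1) ^+ #[t] = 1 by rewrite -(orderJ t s^-1) expg_order.
  have -> : t ^ s^-1 = t * f by rewrite /f !conjgE invgK !mulgA mulgV mul1g.
  by rewrite expgMn ?expg_order ?mul1g //; apply/commute_sym.
have /eqP : #[f] == 1%N.
  rewrite -dvdn1 -(_ : gcdn #[s] #[t] = 1%N); first by rewrite dvdn_gcd !order_dvdn fs ft !eqxx.
  by apply/eqP/(@pnat_coprime pi); apply: p_elt_constt.
move/eqP; rewrite order_eq1 /f => /eqP/(canRL (mulgK _)); rewrite invgK mul1g.
by move=> E; apply/commgP/conjg_fixP.
Qed.

Section Splitting.
Variables (gT : finGroupType) (u v : nat) (x y : gT) (pi : nat_pred).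
Hypothesis Mxy : Mac u.+1 v.+1 x y.

Lemma Mac_constt_commg : [~ x.`_pi, y.`_pi] = [~ x, y].`_pi.
Proof.
apply: (mulgI x.`_pi); rewrite -(Mac_constt_conjx pi Mxy) -conjg_mulR.
rewrite -{2}(consttC pi y) (_ : y.`_pi * _ = y.`_pi^' * y.`_pi); last first.
  have /cycleP[i ->] := cycle_constt pi y; have /cycleP[j ->] := cycle_constt pi^' y.
  exact: commuteX2.
by rewrite conjgM (conjg_fixP (introT commgP (Mac_commute_constt pi Mxy))).
Qed.

Lemma Mac_constt_conjx_comm : x.`_pi ^ [~ x, y].`_pi = x.`_pi ^+ u.+1.
Proof.
rewrite -consttX -(Mac_conjx Mxy) consttJ -{2}(consttC pi^' [~ x, y]) consttNK conjgM.
rewrite [x.`_pi ^ [~ x, y].`_pi^'](conjg_fixP _) //; apply/commgP/commute_sym.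
by have := Mac_commute_constt_x pi^' Mxy; rewrite consttNK.
Qed.
End Splitting.

Lemma Mac_constt (gT : finGroupType) u v (x y : gT) pi :
  Mac u.+1 v.+1 x y -> Mac u.+1 v.+1 x.`_pi y.`_pi.
Proof.
move=> Mxy; split; first by rewrite (Mac_constt_commg pi Mxy) (Mac_constt_conjx_comm pi Mxy).
by rewrite (Mac_constt_commg pi (Mac_sym Mxy)) (Mac_constt_conjx_comm pi (Mac_sym Mxy)).
Qed.

(** The pi-parts and the pi'-parts of the generators generate commuting subgroups H and K with G = H
    K; by [Mac_pgroup] they are a pi-group and a pi'-group. *)
Lemma Mac_constt_Sylow (gT : finGroupType) u v (x y : gT) pi :
  Mac u.+1 v.+1 x y ->
  <<[set x.`_pi; y.`_pi]>> <| <<[set x; y]>> /\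
  pi.-Hall(<<[set x; y]>>) <<[set x.`_pi; y.`_pi]>>.
Proof.
move=> Mxy; set G := <<[set x; y]>>.
have pgr pi1 : pi1.-group <<[set x.`_pi1; y.`_pi1]>>.
  by rewrite (Mac_pgroup (Mac_constt pi1 Mxy)) ?(Mac_constt_commg pi1 Mxy) ?p_elt_constt.
pose H := <<[set x.`_pi; y.`_pi]>>%G; pose K := <<[set x.`_pi^'; y.`_pi^']>>%G.
have cc (g : gT) : commute g.`_pi g.`_pi^'.
  have /cycleP[i ->] := cycle_constt pi g; have /cycleP[j ->] := cycle_constt pi^' g.
  exact: commuteX2.
have cHK : K \subset 'C(H).
  rewrite /K /H /= gen_subG /= cent_gen; apply/subsetP=> _ /set2P[]->; apply/centP=> _ /set2P[]->.
  - exact: (commute_sym (cc _)).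
  - by have := Mac_commute_constt pi^' Mxy; rewrite consttNK.
  - exact/commute_sym/(Mac_commute_constt pi Mxy).
  - exact: (commute_sym (cc _)).
have GE : G = H * K.
  rewrite -(cent_joinEr cHK); apply/eqP; rewrite eqEsubset !gen_subG; apply/andP; split.
    apply/subsetP=> z Hz; rewrite -(consttC pi z) groupM //.
      by rewrite mem_gen // inE mem_gen //; case/set2P: Hz => ->; rewrite !inE eqxx ?orbT.
    by rewrite mem_gen // inE orbC mem_gen //; case/set2P: Hz => ->; rewrite !inE eqxx ?orbT.
  have inG pi1 z : z \in [set x; y] -> z.`_pi1 \in G.
    by move=> Hz; have /cycleP[i ->] := cycle_constt pi1 z; rewrite groupX // mem_gen.
  by rewrite subUset !gen_subG; apply/andP; split; apply/subsetP=> _ /set2P[]->;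
     apply: inG; rewrite !inE eqxx ?orbT.
have sHG : H \subset G by rewrite GE mulG_subl.
have nH : G \subset 'N(H) by rewrite GE mul_subG ?normG // cents_norm.
split; first exact/andP.
rewrite /pHall sHG (pgr pi) /= -/(gval H).
have : #|G : H| %| #|K|.
  rewrite -(dvdn_pmul2l (cardG_gt0 H)) (Lagrange sHG) mul_cardG -GE.
  exact: dvdn_mulr.
by move/pnat_dvd; apply; apply: pgr.
Qed.

(** * The upper bound *)

Lemma p_elt_expg_cycle (gT : finGroupType) p (z : gT) n k :
  prime p -> p.-elt z -> ~~ (p %| k) -> z ^+ n \in <[z ^+ (n * k)]>.
Proof.
move=> pp pz pk; have cop : coprime #|<[z ^+ n]>| k.
  by rewrite (pnat_coprime (p_eltX n pz)) // p'natE.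
by rewrite expgM -{1}(expgK cop (cycle_id _)) mem_cycle.
Qed.

Lemma p_elt_expg_eq1 (gT : finGroupType) p (z : gT) n k :
  prime p -> p.-elt z -> ~~ (p %| k) -> z ^+ (n * k) = 1 -> z ^+ n = 1.
Proof.
by move=> pp pz pk E; have := p_elt_expg_cycle n pp pz pk; rewrite E cycle1 => /set1gP.
Qed.

Section Fundamental.
Variables (gT : finGroupType) (a b : nat) (x y : gT).
Hypothesis Mxy : Mac a b x y.
Local Notation c := [~ x, y].

(* Both sides compute x ^ (y ^+ b), as y ^+ b is a conjugate of y by c^-1. *)
Lemma Mac_conj_relation :
  c ^+ a * x ^+ brk a a = x * (y ^- (b * brk b b) * c ^+ b * y ^+ b).
Proof.
have <- : x ^ (y ^+ b) = c ^+ a * x ^+ brk a a.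
  rewrite -(Mac_conjy Mxy) [y ^ _]conjgE invgK mulgA (conjgM x (c * y)) (conjgM x c) (Mac_conjx Mxy) (Mac_expx Mxy).
  have Ec : (c ^+ a) ^ c^-1 = c ^+ a.
    by apply/conjg_fixP/commgP/commute_sym/commuteX/commute_sym/commuteV.
  by rewrite conjMg Ec expgM -(Mac_conjx Mxy) -conjXg conjgK.
have -> : x ^ (y ^+ b) = x * (((y ^+ b) ^ x)^-1 * y ^+ b).
  by rewrite !conjgE !invMg invgK !mulgA mulgV mul1g.
by rewrite (Mac_expy Mxy) invMg invgK.
Qed.

(** In [Mac_conj_relation], moving x^-1 past c^a turns it into x^-(a^a), and moving y^b past c^b
    turns it into y^(b b^b); only the differences X and Y survive. *)
Lemma Mac_expn_sub_brk X Y : (a ^ a = brk a a + X)%N -> (b ^ b = brk b b + Y)%N ->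
  x ^+ X = (y ^- (b * Y)) ^ (c ^+ b) * (c ^- b * c ^+ a).
Proof.
move=> EX EY.
have Ex : x^-1 * c ^+ a = c ^+ a * x ^- (a ^ a).
  have := Mac_conjxn Mxy 1 a; rewrite mul1n => /(congr1 (fun z => z^-1)) <-.
  by rewrite conjgE expg1 !invMg invgK !mulgA mulgV mul1g.
have Ey : c ^+ b * y ^+ b = y ^+ (b * b ^ b) * c ^+ b.
  by rewrite -(Mac_conjyn Mxy) conjgE invgK !mulgA mulgKV.
have : c ^+ a * x ^- X = y ^+ (b * Y) * c ^+ b.
  have := Mac_conj_relation; move/(congr1 (fun z => x^-1 * z)); rewrite mulKg mulgA Ex.
  rewrite -[_ * c ^+ b * _]mulgA Ey EX EY mulnDr !expgD invMg !mulgA mulVg mul1g.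
  by rewrite mulgKV.
move/(congr1 (fun z => z^-1)); rewrite !invMg invgK => /(canRL (mulgK _)).
by rewrite invgK conjgE !mulgA mulgK.
Qed.
End Fundamental.

Definition val_cond p m u := 
  exists2 s, (u = p ^ m * s)%N & ~~ (p %| s) /\ (p = 3 -> u.+1 != 7 %[mod 9]).

(** The situation of the p-parts of the generators. It is symmetric, so each consequence also holds
    with x and y exchanged and c replaced by c^-1. *)
Record pMac (gT : finGroupType) (p m u v : nat) (x y : gT) : Prop := PMac {
  pMac_odd : odd p;
  pMac_prime : prime p;
  pMac_gt0 : (0 < m)%N;
  pMac_rel : Mac u.+1 v.+1 x y;
  pMac_valx : val_cond p m u;
  pMac_valy : val_cond p m v;
  pMac_cong : u = v %[mod p ^ (2 * m)];
  pMac_eltx : p.-elt x;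
  pMac_elty : p.-elt y;
  pMac_eltc : p.-elt [~ x, y] }.

Lemma pMac_sym (gT : finGroupType) p m u v (x y : gT) :
  pMac p m u v x y -> pMac p m v u y x.
Proof.
case=> op pp m0 Mxy vu vv uv px py pc; split=> //; first exact: Mac_sym.
by rewrite -invg_comm /p_elt orderV.
Qed.

Section UpperBound.
Variables (gT : finGroupType) (p m u v : nat) (x y : gT).
Hypothesis H : pMac p m u v x y.
Local Notation c := [~ x, y].
Let pp := pMac_prime H.
Let px := pMac_eltx H.

(** In [Mac_expn_sub_brk], X is p^(2m) k with k prime to p, and the exponent a - b of the trailing
    power of c is a multiple of p^(2m). *)
Lemma pMac_relation : exists2 k, ~~ (p %| k) &
  exists2 y', y' \in <[y]> & exists d,
    x ^+ (p ^ (2 * m) * k) = y' * c ^+ (p ^ (2 * m) * d).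
Proof.
case: H => op _ m0 Mxy [s Eu [ps p3u]] [t Ev [pt p3v]] uv _ _ pc.
have [k Ek pk] := expn_sub_brk op pp m0 Eu ps p3u.
have [l El pl] := expn_sub_brk op pp m0 Ev pt p3v.
exists k => //; exists ((y ^- (v.+1 * (p ^ (2 * m) * l))) ^ (c ^+ v.+1)).
  by rewrite memJ_norm ?groupV ?mem_cycle // (subsetP (Mac_norm_cycle_y Mxy)) ?mem_cycle.
rewrite (Mac_expn_sub_brk Mxy Ek El).
suff /cycleP[d ->] : c ^- v.+1 * c ^+ u.+1 \in <[c ^+ (p ^ (2 * m))]> by exists d; rewrite -expgM.
case: (leqP v u) => [le|/ltnW le].
  have /dvdnP[d Ed] : p ^ (2 * m) %| u - v by rewrite -eqn_mod_dvd //; apply/eqP.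
  have -> : (u.+1 = v.+1 + p ^ (2 * m) * d)%N by rewrite mulnC -Ed addSn subnKC.
  by rewrite expgD mulKg expgM mem_cycle.
have /dvdnP[d Ed] : p ^ (2 * m) %| v - u by rewrite -eqn_mod_dvd //; apply/eqP.
have -> : (v.+1 = u.+1 + p ^ (2 * m) * d)%N by rewrite mulnC -Ed addSn subnKC.
by rewrite expgD invMg mulgKV -groupV invgK expgM mem_cycle.
Qed.

(** Conjugating the relation by c fixes its c-part, so x^(p^(2m) k u) lies in <y>. As v_p(u) = m, so
    does x^(p^(3m)), which is then central and killed by u. *)
Lemma pMac_cent_x3 :
  x ^+ (p ^ (3 * m)) \in 'C(<<[set x; y]>>) /\ x ^+ (p ^ (4 * m)) = 1.
Proof.
have [k pk [y' yy' [d E]]] := pMac_relation.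
have Mxy := pMac_rel H; have [s Eu [ps _]] := pMac_valx H.
have xuy : x ^+ (p ^ (2 * m) * k * u) \in <[y]>.
  have -> : x ^+ (p ^ (2 * m) * k * u) = y' ^ c * y'^-1.
    have := congr1 (fun z => z ^ c) E; rewrite conjMg conjXg (Mac_conjx Mxy) -expgM.
    have -> : (c ^+ (p ^ (2 * m) * d)) ^ c = c ^+ (p ^ (2 * m) * d).
      by rewrite conjXg conjgE mulKg.
    rewrite mulSn addnC expgD [(u * _)%N]mulnC E => /(canRL (mulgK _)) ->.
    by rewrite invMg mulgA mulgK.
  by rewrite groupM ?groupV // memJ_norm // (subsetP (Mac_norm_cycle_y Mxy)) ?cycle_id.
have x3y : x ^+ (p ^ (3 * m)) \in <[y]>.
  have pks : ~~ (p %| k * s) by rewrite Euclid_dvdM // negb_or pk.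
  apply: subsetP (p_elt_expg_cycle (p ^ (3 * m)) pp px pks).
  rewrite cycle_subG (_ : (_ * (k * s) = p ^ (2 * m) * k * u)%N) //.
  by rewrite Eu -[3]/(2 + 1)%N mulnDl mul1n expnD; ring.
have cx := Mac_centx (mem_cycle _ _) x3y.
split=> //; apply: (p_elt_expg_eq1 pp px ps).
rewrite -(Mac_cent_expn Mxy (erefl _) (mem_cycle _ _) cx) -expgM Eu.
by congr (_ ^+ _); rewrite -[4]/(3 + 1)%N mulnDl mul1n expnD; ring.
Qed.

(** From c^n y c^-n = y^(b^n), the factor is y^(b^n - 1) = y^(v [n]_b), where p^m divides v and
    p^(2m) divides [n]_b. *)
Lemma pMac_conj_c n : p ^ (2 * m) %| n ->
  exists2 z, z \in <[y ^+ (p ^ (3 * m))]> & (c ^+ n) ^ y = z * c ^+ n.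
Proof.
move=> pn; have Mxy := pMac_rel H; exists (y ^+ (v * brk v.+1 n)).
  have [t -> _] := pMac_valy H.
  have [e ->] := brk_pow_dvd (pMac_odd H) (pMac_gt0 H) (dvdn_mulr t (dvdnn _)) pn.
  case/dvdnP: pn => n' ->.
  rewrite (_ : (_ * _ = p ^ (3 * m) * (t * (n' + p ^ m * e)))%N).
    by rewrite expgM mem_cycle.
  by rewrite -[3]/(1 + 2)%N mulnDl mul1n !expnD; ring.
have E := Mac_conjyn Mxy 1 n; rewrite mul1n brk_geo expgD expg1 in E.
by apply: (mulgI y); rewrite [RHS]mulgA -E !conjgE invgK !mulgA mulgV mul1g mulgKV.
Qed.


Lemma pMac_brk n : p ^ (2 * m) %| n -> exists e, brk u.+1 n = n + p ^ (3 * m) * e.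
Proof.
have [s Eu _] := pMac_valx H => pn.
have pu : p ^ m %| u by rewrite Eu dvdn_mulr.
have [e ->] := brk_pow_dvd (pMac_odd H) (pMac_gt0 H) pu pn.
by exists e; rewrite -[3]/(1 + 2)%N mulnDl mul1n.
Qed.

Lemma pMac_brk_cent n : p ^ (2 * m) %| n ->
  exists2 z, z \in <[x ^+ (p ^ (3 * m))]> & x ^+ (u.+1 * brk u.+1 n) = x ^+ n * z.
Proof.
move=> pn; have [e ->] := pMac_brk pn; have [s Eu _] := pMac_valx H.
case/dvdnP: pn => n' ->.
exists (x ^+ (p ^ (3 * m) * (s * n' + u.+1 * e))); first by rewrite expgM mem_cycle.
rewrite -expgD; congr (_ ^+ _); rewrite Eu -[3]/(1 + 2)%N mulnDl mul1n !expnD; ring.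
Qed.
End UpperBound.

Section ExactOrders.
Variables (gT : finGroupType) (p m u v : nat) (x y : gT).
Hypothesis H : pMac p m u v x y.
Local Notation c := [~ x, y].
Local Notation G := <<[set x; y]>>.
Let pp := pMac_prime H.
Let px := pMac_eltx H.

Let sy : <[y ^+ (p ^ (3 * m))]> \subset 'C(G).
Proof. by rewrite cycle_subG setUC; case: (pMac_cent_x3 (pMac_sym H)). Qed.

(** Conjugating the relation by y shows that c^X is a product of central elements. Hence x =
    x^(a^X), where a^X - 1 = u [X]_a has valuation 3m, up to multiples of p^(4m) which kill x. The
    second part is conditional because the order of y comes from the first part for the exchanged
    pair; then z = w = 1. *)
Lemma pMac_x3_c2 : x ^+ (p ^ (3 * m)) = 1 /\ 
  (y ^+ (p ^ (3 * m)) = 1 -> c ^+ (p ^ (2 * m)) = 1 /\ x ^+ (p ^ (2 * m)) \in <[y]>).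
Proof.
have Mxy := pMac_rel H; have [s Eu [ps _]] := pMac_valx H.
have [k pk [y' yy' [d E]]] := pMac_relation H.
have [cx x4] := pMac_cent_x3 H.
have sx : <[x ^+ (p ^ (3 * m))]> \subset 'C(G) by rewrite cycle_subG.
set X := (p ^ (2 * m) * k)%N in E *; have pX : p ^ (2 * m) %| X by rewrite dvdn_mulr.
have [z zy Ez] := pMac_conj_c H (dvdn_mulr d (dvdnn (p ^ (2 * m)))).
have [w wx Ew] := pMac_brk_cent H pX.
have xG : x \in G by rewrite mem_gen // !inE eqxx.
have yG : y \in G by rewrite mem_gen // !inE eqxx orbT.
have cG : c \in G by rewrite groupR.
have zC := subsetP sy _ zy; have wC := subsetP sx _ wx.
have Ec : c ^+ X = z * w^-1.
  have : (x ^+ X) ^ y = x ^+ X * z.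
    have y'G : y' \in G by case/cycleP: yy' => i ->; rewrite groupX.
    rewrite {1}E conjMg Ez E -[RHS]mulgA (centP zC) ?groupX //.
    by congr (_ * _); case/cycleP: yy' => i ->; rewrite conjXg conjgE mulKg.
  rewrite (Mac_expx Mxy) Ew => /(canRL (mulgK _)) ->.
  by rewrite -(centP zC) ?groupX // invMg -!mulgA; congr (_ * _);
     rewrite mulgA -(centP (groupVr wC)) ?groupX // mulgK.
have cX : c ^+ X \in 'C(G) by rewrite Ec groupM ?groupV.
have x3 : x ^+ (p ^ (3 * m)) = 1.
  apply: (@p_elt_expg_eq1 _ p _ _ (k * s) pp px); first by rewrite Euclid_dvdM // negb_or pk.
  have := Mac_conjxn Mxy 1 X; rewrite mul1n brk_geo expg1.
  rewrite (conjg_fixP _); last exact/commgP/commute_sym/(centP cX).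
  rewrite add1n expgS => /(canLR (mulKg x)); rewrite mulVg.
  have [e ->] := pMac_brk H pX; rewrite mulnDr expgD => E1; rewrite [RHS]E1.
  have -> : (u * (p ^ (3 * m) * e) = p ^ (4 * m) * (s * e))%N.
    by rewrite Eu -[4]/(1 + 3)%N mulnDl mul1n !expnD; ring.
  rewrite [x ^+ (p ^ (4 * m) * _)]expgM x4 expg1n mulg1; congr (_ ^+ _).
  by rewrite Eu /X -[3]/(1 + 2)%N mulnDl mul1n !expnD; ring.
split=> // y3.
have c2 : c ^+ (p ^ (2 * m)) = 1.
  apply: (p_elt_expg_eq1 pp (pMac_eltc H) pk); rewrite -/X Ec.
  move: zy wx; rewrite x3 y3 cycle1 => /set1gP-> /set1gP->; exact: mulgV.
split=> //; apply: (subsetP _ _ (p_elt_expg_cycle (p ^ (2 * m)) pp px pk)).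
by rewrite -/X cycle_subG E expgM c2 expg1n mulg1.
Qed.
End ExactOrders.

(** * Central series and order of the p-group *)

(** Commutators need testing only on generators: as the n-th term is normal, the g with [z, g] in it
    form a subgroup. *)
Lemma mem_ucnS_gen (gT : finGroupType) (A : {set gT}) n z :
  z \in <<A>> -> {in A, forall g, [~ z, g] \in 'Z_n(<<A>>)} -> z \in 'Z_n.+1(<<A>>).
Proof.
move=> zG zA; have nZ : 'Z_n(<<A>>) <| <<A>> by apply: ucn_normal.
have gS : group_set [set g in <<A>> | [~ z, g] \in 'Z_n(<<A>>)].
  apply/group_setP; split=> [|g h]; first by rewrite inE group1 commg1 group1.
  rewrite !inE => /andP[gG gZ] /andP[hG hZ]; rewrite groupM // commgMJ groupM //.
  by rewrite memJ_norm // (subsetP (normal_norm nZ)).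
rewrite ucnSnR inE zG gen_subG; apply/subsetP=> _ /imset2P[_ g /set1P-> gG ->].
suff /subsetP/(_ g gG) : <<A>> \subset Group gS by rewrite inE gG.
by rewrite gen_subG; apply/subsetP=> h hA; rewrite inE mem_gen // zA.
Qed.

Lemma mem_commVg (gT : finGroupType) (G N : {group gT}) z g : N <| G ->
  z \in G -> [~ z, g] \in N -> [~ z^-1, g] \in N.
Proof.
move=> nN zG zN; have -> : [~ z^-1, g] = [~ z, g]^-1 ^ z^-1.
  by rewrite !commgEl !conjgE !invMg !invgK !mulgA mulgK.
by rewrite memJ_norm ?groupV // (subsetP (normal_norm nN)) ?groupV.
Qed.

Section Structure.
Variables (gT : finGroupType) (p m u v : nat) (x y : gT).
Hypothesis H : pMac p m u v x y.
Local Notation c := [~ x, y].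
Local Notation G := <<[set x; y]>>.

Lemma pMac_x3 : x ^+ (p ^ (3 * m)) = 1.
Proof. by case: (pMac_x3_c2 H). Qed.

Lemma pMac_y3 : y ^+ (p ^ (3 * m)) = 1.
Proof. by case: (pMac_x3_c2 (pMac_sym H)). Qed.

Lemma pMac_c2 : c ^+ (p ^ (2 * m)) = 1.
Proof. by case: (pMac_x3_c2 H) => _ []; first exact: pMac_y3. Qed.

Lemma pMac_x2 : x ^+ (p ^ (2 * m)) \in <[y]>.
Proof. by case: (pMac_x3_c2 H) => _ []; first exact: pMac_y3. Qed.

Lemma pMac_pgroup : p.-group G.
Proof. exact: (Mac_pgroup (pMac_rel H) (pMac_eltx H) (pMac_elty H) (pMac_eltc H)). Qed.

Let xG : x \in G. Proof. by rewrite mem_gen // !inE eqxx. Qed.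
Let yG : y \in G. Proof. by rewrite mem_gen // !inE eqxx orbT. Qed.
Let cG : c \in G. Proof. exact: groupR. Qed.

Lemma pMac_commg_xc n : [~ x ^+ n, c] = x ^+ (n * u).
Proof.
by rewrite commgEl conjXg (Mac_conjx (pMac_rel H)) -expgM mulSn expgD mulKg mulnC.
Qed.

Lemma pMac_commg_xcn n : [~ x, c ^+ n] = x ^+ (u * brk u.+1 n).
Proof.
have := Mac_conjxn (pMac_rel H) 1 n; rewrite mul1n expg1 => E.
by rewrite commgEl E brk_geo expgD mulKg.
Qed.

Lemma pMac_commg_xy n : [~ x ^+ n, y] = x ^- n * c ^+ n * x ^+ (u.+1 * brk u.+1 n).
Proof. by rewrite commgEl (Mac_expx (pMac_rel H)) mulgA. Qed.

Lemma pMac_ucn1 : <[x ^+ (p ^ (2 * m))]> \subset 'Z_1(G).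
Proof.
rewrite ucn1 cycle_subG /center inE groupX //=.
exact: Mac_centx (mem_cycle _ _) pMac_x2.
Qed.

Lemma pMac_commg_x_c1 : [~ x, c ^+ (p ^ m)] \in <[x ^+ (p ^ (2 * m))]>.
Proof.
have [s Eu _] := pMac_valx H.
have pu : p ^ m %| u by rewrite Eu dvdn_mulr.
have [e E] := brk_pow_dvd (pMac_odd H) (pMac_gt0 H) pu (dvdnn (p ^ m)).
rewrite pMac_commg_xcn E.
have -> : (u * (p ^ m + p ^ (m + m) * e) = p ^ (2 * m) * (s * (1 + p ^ m * e)))%N.
  by rewrite Eu mulSn mul1n !expnD; ring.
by rewrite expgM mem_cycle.
Qed.

Lemma pMac_commg_c1_x : [~ c ^+ (p ^ m), x] \in 'Z_1(G).
Proof. by rewrite -invg_comm groupV (subsetP pMac_ucn1) ?pMac_commg_x_c1. Qed.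

(** With n = p^m, [x^n, y] is a conjugate of c^n times a power of the central element x^(p^(2m)). *)
Lemma pMac_x1_ucn3 : c ^+ (p ^ m) \in 'Z_2(G) -> x ^+ (p ^ m) \in 'Z_3(G).
Proof.
move=> c1Z; apply: mem_ucnS_gen => [|_ /set2P[]->]; first exact: groupX.
  by rewrite (_ : [~ _, _] = 1) ?group1 //; apply/eqP/commgP/commute_sym/commuteX.
have [s Eu _] := pMac_valx H.
have pu : p ^ m %| u by rewrite Eu dvdn_mulr.
have [e E] := brk_pow_dvd (pMac_odd H) (pMac_gt0 H) pu (dvdnn (p ^ m)).
rewrite pMac_commg_xy.
have -> : (u.+1 * brk u.+1 (p ^ m) = p ^ m + p ^ (2 * m) * (s + u.+1 * e))%N.
  by rewrite E Eu mul2n -addnn !expnD; ring.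
rewrite expgD mulgA -[x ^- _ * _ * _]mulgA -conjgE groupM //.
  by rewrite memJ_norm // (subsetP (normal_norm (ucn_normal _ _))) ?groupX.
rewrite (subsetP (ucn_sub_geq _ (_ : 1 <= 2)%N)) // (subsetP pMac_ucn1) //.
by rewrite expgM mem_cycle.
Qed.

Lemma pMac_commg_c_x : x ^+ (p ^ m) \in 'Z_3(G) -> [~ c, x] \in 'Z_3(G).
Proof.
have [s Eu _] := pMac_valx H.
by move=> x1; rewrite -invg_comm groupV -[x in [~ x, _]]expg1 pMac_commg_xc mul1n Eu expgM groupX.
Qed.

(** The witness in the fifth term is [x, [x^u, y]], where x^u = [x, c]. It equals x^(a^u - 1) = x^(u
    [u]_a), whose exponent has valuation exactly 2m. *)
Lemma pMac_nil_class_ge5 : #[x] = (p ^ (3 * m))%N -> (4 < nil_class G)%N.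
Proof.
move=> ox; rewrite ltnNge; apply/negP => cl.
have nG := pgroup_nil pMac_pgroup.
have [s Eu [ps _]] := pMac_valx H.
have pu : p ^ m %| u by rewrite Eu dvdn_mulr.
have c2 : c \in 'L_2(G) by rewrite lcnSn mem_commg.
have x3 : x ^+ u \in 'L_3(G).
  by rewrite lcnSn commGC -[u]mul1n -pMac_commg_xc expg1 mem_commg.
have x4 : [~ x ^+ u, y] \in 'L_4(G) by rewrite lcnSn mem_commg.
have x5 : [~ x, [~ x ^+ u, y]] \in 'L_5(G) by rewrite lcnSn commGC mem_commg.
move: x5; rewrite (lcn_nil_classP 4 nG cl) => /set1gP.
have E := Mac_conjxn (pMac_rel H) 1 u; rewrite mul1n expg1 in E.
have xx n : x ^+ n ^ x ^+ (u.+1 * brk u.+1 u) = x ^+ n.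
  by apply/conjg_fixP/commgP/commuteX2.
rewrite pMac_commg_xy commgEl (conjgM x (_ * _)) (conjgM x (x ^- u)).
have -> : x ^ x ^- u = x by apply/conjg_fixP/commgP/commuteV/commuteX.
rewrite E xx brk_geo expgD mulKg.
have [e ->] := brk_pow_dvd (pMac_odd H) (pMac_gt0 H) pu pu.
have -> : (u * (u + p ^ (m + m) * e) = p ^ (2 * m) * (s * s + p ^ m * s * e))%N.
  by rewrite Eu mul2n -addnn !expnD; ring.
move/(p_elt_expg_eq1 (pMac_prime H) (pMac_eltx H)) => x2.
have /eqP : x ^+ (p ^ (2 * m)) = 1.
  have pd : p %| p ^ m * s * e by rewrite -mulnA dvdn_mulr // dvdn_exp ?(pMac_gt0 H).
  by apply: x2; rewrite dvdn_addl // Euclid_dvdM ?orbb ?(pMac_prime H).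
rewrite -order_dvdn ox dvdn_Pexp2l ?prime_gt1 ?(pMac_prime H) // leq_pmul2r ?(pMac_gt0 H) //.
Qed.

End Structure.

Section StructureSym.
Variables (gT : finGroupType) (p m u v : nat) (x y : gT).
Hypothesis H : pMac p m u v x y.
Local Notation c := [~ x, y].
Local Notation G := <<[set x; y]>>.
Let H' := pMac_sym H.
Let GE : <<[set y; x]>> = G. Proof. by rewrite setUC. Qed.
Let cG : c \in G.
Proof. by rewrite groupR // mem_gen // !inE eqxx ?orbT. Qed.

(** The upper central series is climbed from x^(p^(2m)) in the first term to c^(p^m), then x^(p^m)
    and y^(p^m), then c, and finally x and y in the fifth. *)
Lemma pMac_nil_class_le5 : (nil_class G <= 5)%N.
Proof.
have nG := pgroup_nil (pMac_pgroup H).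
have nZ n : 'Z_n(G) <| G by apply: ucn_normal.
have c1 : c ^+ (p ^ m) \in 'Z_2(G).
  have c1V : [~ (c ^+ (p ^ m))^-1, y] \in 'Z_1(G).
    by have := pMac_commg_c1_x H'; rewrite GE -(invg_comm x y) expgVn.
  apply: mem_ucnS_gen => [|_ /set2P[]->]; [exact: groupX | exact: pMac_commg_c1_x H|].
  by have := mem_commVg (nZ 1%N) (groupVr (groupX _ cG)) c1V; rewrite invgK.
have x1 := pMac_x1_ucn3 H c1.
have y1 : y ^+ (p ^ m) \in 'Z_3(G).
  by have := pMac_x1_ucn3 H'; rewrite GE -(invg_comm x y) expgVn groupV; apply.
have c4 : c \in 'Z_4(G).
  have cV : [~ c^-1, y] \in 'Z_3(G).
    by have := pMac_commg_c_x H'; rewrite GE -(invg_comm x y); apply.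
  apply: mem_ucnS_gen => [//|_ /set2P[]->]; first exact: pMac_commg_c_x H x1.
  by have := mem_commVg (nZ 3%N) (groupVr cG) cV; rewrite invgK.
apply/(ucn_nil_classP 5 nG)/eqP; rewrite eqEsubset ucn_sub gen_subG.
have c4' : [~ y, x] \in 'Z_4(G) by rewrite -(invg_comm x y) groupV.
have xG : x \in G by rewrite mem_gen // !inE eqxx.
have yG : y \in G by rewrite mem_gen // !inE eqxx orbT.
apply/subsetP=> _ /set2P[]->; [apply: (mem_ucnS_gen xG) | apply: (mem_ucnS_gen yG)].
  by move=> _ /set2P[]->; [rewrite commgg group1 | exact: c4].
by move=> _ /set2P[]->; [exact: c4' | rewrite commgg group1].
Qed.

(** G = <y> K with K = <c><x> of order at most p^(5m), and <y> meets K in at least the p^m powers of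
    x^(p^(2m)); 3m + 5m - m = 7m. *)
Lemma pMac_card_le : #[x] = (p ^ (3 * m))%N -> (#|G| <= p ^ (7 * m))%N.
Proof.
move=> ox; have Mxy := pMac_rel H.
have p0 := prime_gt0 (pMac_prime H).
have cle (z : gT) n : z ^+ (p ^ n) = 1 -> (#|<[z]>| <= p ^ n)%N.
  by move/eqP; rewrite -order_dvdn; apply: dvdn_leq; rewrite expn_gt0 p0.
rewrite (Mac_factor Mxy) -mulgA -(norm_joinEl (Mac_norm_cycle_x Mxy)).
set K := <[c]> <*> <[x]>.
have cK : (#|K| <= p ^ (5 * m))%N.
  rewrite -[5]/(2 + 3)%N mulnDl expnD /K (norm_joinEl (Mac_norm_cycle_x Mxy)).
  apply: (leq_trans _ (leq_mul (cle _ _ (pMac_c2 H)) (cle _ _ (pMac_x3 H)))).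
  by rewrite mul_cardG leq_pmulr ?cardG_gt0.
have cI : (p ^ m <= #|<[y]> :&: K|)%N.
  have -> : (p ^ m = #|<[x ^+ (p ^ (2 * m))]>|)%N.
    by rewrite -orderE (orderXexp _ ox) -mulnBl mul1n.
  rewrite subset_leq_card // subsetI cycle_subG (pMac_x2 H) cycle_subG groupX //.
  by rewrite mem_gen // inE cycle_id orbT.
rewrite -(leq_pmul2r (_ : 0 < p ^ m)%N) ?expn_gt0 ?p0 // -expnD.
have -> : (7 * m + m = 3 * m + 5 * m)%N by ring.
rewrite expnD; apply: (leq_trans _ (leq_mul (cle _ _ (pMac_y3 H)) cK)).
by rewrite mul_cardG leq_mul.
Qed.
End StructureSym.

(** * Iterating the q-exponential i |-> [i]_q modulo the cube of q - 1 *)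

Local Open Scope ring_scope.

Section TruncatedIteration.
Variables (R : comNzRingType) (h : R) (w : nat).
Hypothesis h2 : h * 2%:R = 1.
Local Notation W := (w%:R : R).

Lemma natr_bin2 n : 'C(n, 2)%:R = h * (n%:R * (n%:R - 1)) :> R.
Proof.
have /(congr1 (fun k => h * k%:R)) := bin_ffact n 2.
rewrite (_ : 2`! = 2)%N // natrM mulrCA h2 mulr1 => ->.
rewrite !ffactnS ffactn0 muln1 natrM.
by case: n => [|n]; rewrite /= ?mulr0n ?mul0r // -natr1 addrK.
Qed.

Lemma natr_brk n : W ^+ 3 = 0 ->
  (brk w.+1 n)%:R = n%:R + h * (n%:R * (n%:R - 1)) * W + 'C(n, 3)%:R * W ^+ 2 :> R.
Proof.
move=> w3; have [e ->] := brk_Taylor w n.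
transitivity (n%:R + 'C(n, 2)%:R * W + 'C(n, 3)%:R * W ^+ 2 + W ^+ 3 * e%:R); first by ring.
by rewrite natr_bin2 w3 mul0r addr0.
Qed.

(** In the model below, the n-fold iterate of [actB] sends the coordinate i to [iter_brk n i] and
    adds [sum_brk n i] to the coordinate k. *)
Definition iter_brk n X : nat := iter n (brk w.+1) X.
Definition sum_brk n X : nat := (\sum_(t < n) iter_brk t X)%N.

Lemma iter_brkS n X : iter_brk n.+1 X = brk w.+1 (iter_brk n X).
Proof. by []. Qed.

Lemma sum_brkS n X : sum_brk n.+1 X = (sum_brk n X + iter_brk n X)%N.
Proof. by rewrite /sum_brk big_ord_recr. Qed.

(** * Iterates when W^2 = 0 *)

Section Square.
Hypothesis w2 : W ^+ 2 = 0.
Variable X : nat.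
Local Notation Y := (h * (X%:R * (X%:R - 1))).

Lemma natr_iter_brk2 n : (iter_brk n X)%:R = X%:R + n%:R * W * Y :> R.
Proof.
elim: n => [|n IH]; first by rewrite !mul0r addr0.
have w3 : W ^+ 3 = 0 by rewrite exprS w2 mulr0.
rewrite iter_brkS natr_brk // w2 IH -[n.+1%:R]natr1.
have -> : h * ((X%:R + n%:R * W * Y) * (X%:R + n%:R * W * Y - 1)) * W = Y * W +
  W ^+ 2 * (h * (X%:R * n%:R * Y + n%:R * Y * (X%:R + n%:R * W * Y - 1))) by ring.
by rewrite w2; ring.
Qed.

Lemma natr_sum_brk2 n : (sum_brk n X)%:R = n%:R * X%:R + 'C(n, 2)%:R * W * Y :> R.
Proof.
elim: n => [|n IH]; first by rewrite /sum_brk big_ord0 bin0n !mul0r addr0.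
by rewrite sum_brkS natrD IH natr_iter_brk2 binS bin1 natrD -natr1; ring.
Qed.
End Square.

(** * Iterates when W^3 = 0 *)

Section Cube.
Hypothesis w3 : W ^+ 3 = 0.
Local Notation E := (W ^+ 2 * 'C(w, 3)%:R).

(** 3 need not be invertible, so 'C(X, 3) is not a polynomial in the image of X: each shift by w
    contributes [E]. The other Vandermonde terms contain W^3. *)
Lemma natr_bin3_shift X t :
  W ^+ 2 * 'C(X + w * t, 3)%:R = W ^+ 2 * 'C(X, 3)%:R + t%:R * E.
Proof.
elim: t => [|t IH]; first by rewrite muln0 addn0 mul0r addr0.
rewrite mulnSr addnA bin3D -[t.+1%:R]natr1 mulrDl addrA -{}IH mul1r.
set X' := (X + w * t)%N.
transitivity (W ^+ 2 * 'C(X', 3)%:R + E + W ^+ 3 * 'C(X', 2)%:R + W ^+ 2 * X'%:R * 'C(w, 2)%:R).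
  by ring.
rewrite (natr_bin2 w).
transitivity (W ^+ 2 * 'C(X', 3)%:R + E + W ^+ 3 * ('C(X', 2)%:R + X'%:R * h * (W - 1))); first by ring.
by rewrite w3 mul0r addr0.
Qed.

Variable X : nat.
Local Notation Y := (h * (X%:R * (X%:R - 1))).
Local Notation V := (Y * (h * (2%:R * X%:R - 1) + 'C(w, 3)%:R)).

Lemma natr_iter_brk n : (iter_brk n X)%:R =
  X%:R + n%:R * (W * Y + W ^+ 2 * 'C(X, 3)%:R) + 'C(n, 2)%:R * W ^+ 2 * V :> R.
Proof.
(* The induction also carries the shift t as a natural number, since the cubic binomial of the
   iterate is evaluated by [natr_bin3_shift]; only E t is needed. *)
suff : (iter_brk n X)%:R =
  X%:R + n%:R * (W * Y + W ^+ 2 * 'C(X, 3)%:R) + 'C(n, 2)%:R * W ^+ 2 * V :> R /\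
  exists2 t, iter_brk n X = (X + w * t)%N & E * t%:R = n%:R * E * Y by case.
elim: n => [|n [IH [t Et Ht]]].
  by split; [rewrite /iter_brk bin0n /=; ring | exists 0; rewrite ?muln0 ?addn0 //; ring].
have w3E r : W ^+ 3 * r = 0 by rewrite w3 mul0r.
split.
  rewrite iter_brkS natr_brk // {4}Et [_ * W ^+ 2]mulrC natr_bin3_shift [t%:R * E]mulrC Ht.
  rewrite binS bin1 IH.
  set A := n%:R * (Y + W * 'C(X, 3)%:R) + 'C(n, 2)%:R * W * V.
  transitivity (X%:R + W * A + h * ((X%:R + W * A) * (X%:R + W * A - 1)) * W +
      (W ^+ 2 * 'C(X, 3)%:R + n%:R * E * Y)); first by rewrite /A; ring.
  transitivity (X%:R + W * A + W * Y + W ^+ 2 * (h * (2%:R * X%:R - 1) * n%:R * Y) +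
      (W ^+ 2 * 'C(X, 3)%:R + n%:R * E * Y) +
      W ^+ 3 * (h * A ^+ 2 + h * (2%:R * X%:R - 1) * (n%:R * 'C(X, 3)%:R + 'C(n, 2)%:R * V))).
    by rewrite /A; ring.
  by rewrite w3E /A; ring.
have [e He] := brk_Taylor w (iter_brk n X).
set s := ('C(iter_brk n X, 2) + w * ('C(iter_brk n X, 3) + w * e))%N.
exists (t + s)%N; first by rewrite iter_brkS He {1}Et /s; ring.
rewrite natrD mulrDr Ht /s natrD natr_bin2 Et.
transitivity (n%:R * E * Y + E * Y + W ^+ 3 * 'C(w, 3)%:R * (('C(X + w * t, 3) + w * e)%:R +
   h * (t%:R * (2%:R * X%:R - 1) + W * t%:R ^+ 2))); first by ring.
by rewrite -mulrA w3E; ring.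
Qed.

Lemma natr_sum_brk n : exists z, (sum_brk n X)%:R =
  n%:R * X%:R + 'C(n, 2)%:R * W * Y + W ^+ 2 * z :> R.
Proof.
elim: n => [|n [z IH]]; first by exists 0; rewrite /sum_brk big_ord0 bin0n /=; ring.
exists (z + n%:R * 'C(X, 3)%:R + 'C(n, 2)%:R * V).
by rewrite sum_brkS natrD IH natr_iter_brk binS bin1; ring.
Qed.

Variable r : nat.
Local Notation P := (r%:R : R).
Hypotheses (rw : P * W = W ^+ 2) (r2 : P ^+ 2 = W ^+ 2).

Lemma natr_expn_Taylor n : r.+1%:R ^+ n = 1 + n%:R * P + h * (n%:R * (n%:R - 1)) * P ^+ 2 :> R.
Proof.
have r3 : P ^+ 3 = 0 by rewrite exprS r2 [W ^+ 2]expr2 mulrA rw -exprSr.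
have [e He] := expn_Taylor r n; rewrite -natrX He.
transitivity (1 + n%:R * P + 'C(n, 2)%:R * P ^+ 2 + P ^+ 3 * e%:R); first by ring.
by rewrite r3 natr_bin2 mul0r addr0.
Qed.

(** Each exponential is expanded to second order. The W^2 part of [sum_brk] drops out, because P W^2
    = W^3 = 0. *)
Lemma sum_expn_sum_brk n : \sum_(t < n) r.+1%:R ^+ sum_brk t X =
  n%:R + P * 'C(n, 2)%:R * X%:R + W ^+ 2 *
   ('C(n, 3)%:R * (Y + X%:R ^+ 2) + h * 'C(n, 2)%:R * (X%:R ^+ 2 - X%:R)) :> R.
Proof.
have w3E z : W ^+ 3 * z = 0 by rewrite w3 mul0r.
elim: n => [|n IH]; first by rewrite big_ord0 !bin0n /=; ring.
rewrite big_ord_recr IH /= natr_expn_Taylor r2.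
have [z ->] := natr_sum_brk n.
set S := (X in _ + (1 + X * P + _)).
have SP : S * P = n%:R * X%:R * P + W ^+ 2 * 'C(n, 2)%:R * Y.
  rewrite /S; transitivity (n%:R * X%:R * P + 'C(n, 2)%:R * Y * (P * W) + P * W * W * z); first by ring.
  by rewrite rw -exprSr w3E; ring.
have S2 : S * (S - 1) * W ^+ 2 = n%:R * X%:R * (n%:R * X%:R - 1) * W ^+ 2.
  transitivity (n%:R * X%:R * (n%:R * X%:R - 1) * W ^+ 2 +
    W ^+ 3 * (('C(n, 2)%:R * Y + W * z) * (2%:R * n%:R * X%:R - 1 + W * ('C(n, 2)%:R * Y + W * z)))).
    by rewrite /S; ring.
  by rewrite w3E addr0.
have n2 : n%:R ^+ 2 = 2%:R * 'C(n, 2)%:R + n%:R :> R.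
  by rewrite natr_bin2 mulrA [2%:R * h]mulrC h2; ring.
rewrite -[h * _ * W ^+ 2]mulrA S2 SP (binS n 2) (binS n 1) bin1.
transitivity (n.+1%:R + P * ('C(n, 2) + n)%:R * X%:R + W ^+ 2 *
   (('C(n, 3) + 'C(n, 2))%:R * Y + 'C(n, 3)%:R * X%:R ^+ 2 + h * 'C(n, 2)%:R * (X%:R ^+ 2 - X%:R)) +
   W ^+ 2 * (h * (n%:R ^+ 2 * X%:R ^+ 2 - n%:R * X%:R))); first by ring.
rewrite n2; transitivity (n.+1%:R + P * ('C(n, 2) + n)%:R * X%:R + W ^+ 2 *
   (('C(n, 3) + 'C(n, 2))%:R * Y + 'C(n, 3)%:R * X%:R ^+ 2 + (h * 2%:R) * 'C(n, 2)%:R * X%:R ^+ 2 +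
   h * ('C(n, 2) + n)%:R * (X%:R ^+ 2 - X%:R))); first by ring.
by rewrite h2; ring.
Qed.
End Cube.

(* The corrections E and E' vanish in the application unless p = 3. *)
Section KeyIdentity.
Variables (r v : nat).
Local Notation P := (r%:R : R).
Local Notation E := (W ^+ 2 * 'C(w, 3)%:R).
Local Notation E' := (W ^+ 2 * 'C(v.+1, 3)%:R).
Hypotheses (w3 : W ^+ 3 = 0) (rw : P * W = W ^+ 2) (r2 : P ^+ 2 = W ^+ 2).
Hypotheses (wv : W * v%:R = - W ^+ 2) (rv : r.+1%:R * v.+1%:R = 1 :> R).
Hypotheses (e3 : E' * 3%:R = 0) (eE : E = - E').

(** This is what equality of the last coordinates in [act_conjB] amounts to. Once both sides are
    expanded up to W^2 and E is replaced by -E', their difference is a multiple of 3 E', which is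
    0. *)
Lemma iter_brk_key_identity i k :
  (iter_brk v.+1 (w.+1 * i))%:R +
    r.+1%:R ^+ k.+1 * (\sum_(t < v.+1) r.+1%:R ^+ sum_brk t (w.+1 * i)) =
  w.+1%:R * (brk w.+1 i)%:R + r.+1%:R ^+ k :> R.
Proof.
have w3E z : W ^+ 3 * z = 0 by rewrite w3 mul0r.
have rv' : P * v%:R = - W ^+ 2.
  have E1 : P + v%:R + P * v%:R = 0.
    by transitivity (r.+1%:R * v.+1%:R - 1 : R); [ring | rewrite rv subrr].
  transitivity (P * (P + v%:R + P * v%:R) - P ^+ 2 - P ^+ 2 * v%:R); first by ring.
  rewrite E1 r2 expr2 -[W * W * _]mulrA wv mulr0 sub0r.
  transitivity (- W ^+ 2 + W ^+ 3); [ring | by rewrite w3 addr0].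
have w2v : W ^+ 2 * v%:R = 0 by rewrite expr2 -mulrA wv mulrN -exprS w3 oppr0.
have c2 : 'C(v.+1, 2)%:R = h * v.+1%:R * v%:R :> R by rewrite natr_bin2 -natr1; ring.
have cW z : 'C(v.+1, 2)%:R * W ^+ 2 * z = 0.
  by rewrite c2; transitivity (h * v.+1%:R * z * (W ^+ 2 * v%:R)); [ring | rewrite w2v mulr0].
rewrite (natr_iter_brk w3) cW addr0 (sum_expn_sum_brk w3 _ rw r2).
set X := (w.+1 * i)%N; set Q := r.+1%:R ^+ k.
have QW z : Q * W ^+ 2 * z = W ^+ 2 * z.
  rewrite /Q (natr_expn_Taylor w3 rw r2).
  transitivity (W ^+ 2 * z + k%:R * (P * W) * W * z + h * (k%:R * (k%:R - 1)) * (P * W) * (P * W) * z).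
    by ring.
  rewrite rw; transitivity (W ^+ 2 * z + W ^+ 3 * (k%:R * z + h * (k%:R * (k%:R - 1)) * W * z)); first by ring.
  by rewrite w3E addr0.
have RQW z : r.+1%:R ^+ k.+1 * (W ^+ 2 * z) = W ^+ 2 * z.
  rewrite exprS -/Q -natr1; transitivity (Q * W ^+ 2 * z + (P * W) * (Q * W * z)); first by ring.
  rewrite rw; transitivity (Q * W ^+ 2 * (z + W * z)); first by ring.
  by rewrite QW; transitivity (W ^+ 2 * z + W ^+ 3 * z); [ring | rewrite w3E addr0].
rewrite [_ ^+ k.+1 * _]mulrDr RQW [_ ^+ k.+1 * _]mulrDr.
have -> : r.+1%:R ^+ k.+1 * v.+1%:R = Q by rewrite exprS mulrAC rv mul1r.
have -> : r.+1%:R ^+ k.+1 * (P * 'C(v.+1, 2)%:R * X%:R) = - (W ^+ 2 * (h * X%:R)).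
  rewrite c2; transitivity (Q * (r.+1%:R * v.+1%:R) * (P * v%:R) * h * X%:R).
    by rewrite exprS -/Q; ring.
  rewrite rv rv'; transitivity (- (Q * W ^+ 2 * (h * X%:R))); [ring | by rewrite QW].
rewrite (natr_brk _ w3).
have shift3 : W ^+ 2 * 'C(X, 3)%:R = W ^+ 2 * 'C(i, 3)%:R + i%:R * E.
  by rewrite /X mulSn natr_bin3_shift.
have XE : X%:R = i%:R + i%:R * W :> R by rewrite /X natrM -natr1; ring.
set Y := h * (X%:R * (X%:R - 1)); set c3 := 'C(v.+1, 3)%:R; set C3 := 'C(i, 3)%:R in shift3 *.
transitivity (X%:R + W * Y + W * v%:R * Y + (1 + v%:R) * (W ^+ 2 * 'C(X, 3)%:R) + Q - W ^+ 2 * (h * X%:R) +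
  W ^+ 2 * c3 * (Y + X%:R ^+ 2) + 'C(v.+1, 2)%:R * W ^+ 2 * (h * (X%:R ^+ 2 - X%:R))); first by ring.
rewrite cW addr0 mulrDl mul1r [v%:R * (_ * _)]mulrA [v%:R * _]mulrC w2v mul0r addr0 wv shift3 eE -/c3 /Y XE.
pose Z := h * i%:R ^+ 2 - h * (2%:R * i%:R ^+ 2 - i%:R) - W * h * i%:R ^+ 2 - h * i%:R +
  c3 * (h * (2%:R * i%:R ^+ 2 - i%:R) + 2%:R * i%:R ^+ 2 + W * (h * i%:R ^+ 2 + i%:R ^+ 2)) - C3.
transitivity (w.+1%:R * (i%:R + h * (i%:R * (i%:R - 1)) * W + C3 * W ^+ 2) + Q + W ^+ 3 * Z +
  W ^+ 2 * c3 * (h * (i%:R ^+ 2 - i%:R)) + (h * 2%:R) * (W ^+ 2 * c3) * (i%:R ^+ 2 - i%:R)).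
  by rewrite h2 /Z; ring.
rewrite w3E addr0 -addrA.
rewrite (_ : W ^+ 2 * c3 * _ + _ = W ^+ 2 * c3 * 3%:R * (h * (i%:R ^+ 2 - i%:R))); last by ring.
by rewrite e3 mul0r addr0.
Qed.
End KeyIdentity.
End TruncatedIteration.

(** * A permutation model of order at least p^(7m) *)

Lemma natrZ_dvd N n : (1 < N)%N -> (N %| n)%N -> n%:R = 0 :> 'Z_N.
Proof. by move=> N1 /dvdnP[k ->]; rewrite natrM pchar_Zp ?mulr0. Qed.

Lemma Zp_half N : (1 < N)%N -> odd N -> (uphalf N)%:R * 2%:R = 1 :> 'Z_N.
Proof.
move=> N1 oN; rewrite -natrM muln2 -[RHS]addr0 -(pchar_Zp N1) nat1r.
by rewrite uphalfE -[in RHS](odd_double_half N.+1) /= oN.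
Qed.

Section PermutationModel.
Variables (p m u v : nat).
Hypotheses (op : odd p) (pp : prime p) (m0 : (0 < m)%N).
Hypotheses (pu : (p ^ m %| u)%N) (pv : (p ^ m %| v)%N) (uv : (u = v %[mod p ^ (2 * m)])%N).
Let M2 := (p ^ (2 * m))%N.
Let M3 := (p ^ (3 * m))%N.

(* w + 1 and r + 1 represent the inverses of u + 1 and v + 1 modulo p^(3m). *)
Definition inv_pred t := (t.+1 ^ M3.-1).-1.
Local Notation w := (inv_pred u).
Local Notation r := (inv_pred v).

Lemma gt1_expp k : (0 < k)%N -> (1 < p ^ (k * m))%N.
Proof. by move=> k0; rewrite -(exp1n (k * m)) ltn_exp2r ?prime_gt1 ?muln_gt0 ?k0. Qed.
Let M2gt1 : (1 < M2)%N := gt1_expp (isT : 0 < 2)%N.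
Let M3gt1 : (1 < M3)%N := gt1_expp (isT : 0 < 3)%N.

Lemma inv_predS t : (inv_pred t).+1 = (t.+1 ^ M3.-1)%N.
Proof. by rewrite prednK // expn_gt0. Qed.

Lemma inv_pred_dvd t : (p ^ m %| t)%N -> (p ^ m %| inv_pred t)%N.
Proof. by move=> pt; rewrite /inv_pred brk_geo add1n /= dvdn_mulr. Qed.

(** t + 1 is 1 modulo p^m, so its p^(3m)-th power is 1 modulo p^(3m); hence the exponent [M3.-1] in
    [inv_pred]. *)
Lemma inv_predM t : (p ^ m %| t)%N -> exists e, ((inv_pred t).+1 * t.+1 = 1 + M3 * e)%N.
Proof.
move=> pt; rewrite inv_predS -expnSr prednK ?(ltnW M3gt1) // brk_geo.
have [c ->] := brk_pow_dvd op m0 pt (dvdnn (p ^ (3 * m))).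
by exists (t * (1 + p ^ m * c))%N; rewrite expnD -/M3; ring.
Qed.

Lemma inv_predD t : (p ^ m %| t)%N -> (M2 %| inv_pred t + t)%N.
Proof.
move=> pt; have [e E] := inv_predM pt; have /dvdnP[a Ea] := inv_pred_dvd pt.
have : (M2 %| inv_pred t * t + (inv_pred t + t))%N.
  have -> : (inv_pred t * t + (inv_pred t + t) = M2 * (p ^ m * e))%N.
    apply: (@addnI 1); transitivity ((inv_pred t).+1 * t.+1)%N; first by ring.
    by rewrite E /M3 /M2 -[3%N]/(2 + 1)%N mulnDl mul1n expnD; ring.
  exact: dvdn_mulr.
rewrite dvdn_addr // Ea; case/dvdnP: pt => b ->.
by apply/dvdnP; exists (a * b)%N; rewrite /M2 mul2n -addnn expnD; ring.
Qed.

Lemma inv_predDv : (M2 %| w + v)%N.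
Proof.
by rewrite /dvdn -modnDmr -uv modnDmr; apply: inv_predD.
Qed.

Let R := 'Z_M3.
Let S := 'Z_M2.

(** These are the hypotheses of [iter_brk_key_identity]. Modulo p^(2m) both w and r are -v, and w
    kills multiples of p^(2m). For the last two, 6 'C(v+1, 3) is a multiple of v with w^2 v = 0, and
    'C(w+v, 3), divisible by p^m, is killed by w^2. *)
Lemma Zp3m_identities : let h := (uphalf M3)%:R : R in
  [/\ h * 2%:R = 1, w%:R ^+ 3 = 0 :> R, r%:R * w%:R = w%:R ^+ 2 :> R &
   [/\ r%:R ^+ 2 = w%:R ^+ 2 :> R, w%:R * v%:R = - w%:R ^+ 2 :> R, r.+1%:R * v.+1%:R = 1 :> R,
     w%:R ^+ 2 * 'C(v.+1, 3)%:R * 3%:R = 0 :> R &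
     w%:R ^+ 2 * 'C(w, 3)%:R = - (w%:R ^+ 2 * 'C(v.+1, 3)%:R) :> R]].
Proof.
move=> h; have h2 : h * 2%:R = 1 by apply: Zp_half; rewrite // oddX op orbT.
have pi3 : (p ^ m)%:R ^+ 3 = 0 :> R by rewrite -natrX -expnM mulnC pchar_Zp.
have pi3z z : (p ^ m)%:R ^+ 3 * z = 0 :> R by rewrite pi3 mul0r.
have M2E : M2%:R = (p ^ m)%:R ^+ 2 :> R by rewrite -natrX -expnM mulnC.
have /dvdnP[a /(congr1 (fun n => n%:R : R))] := inv_pred_dvd pu; rewrite natrM => Wa.
have /dvdnP[s /(congr1 (fun n => n%:R : R))] := inv_predDv; rewrite natrM M2E natrD => Es.
have /dvdnP[s' /(congr1 (fun n => n%:R : R))] := inv_predD pv; rewrite natrM M2E natrD => Es'.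
set pi := (p ^ m)%:R in pi3 pi3z Wa Es Es' M2E.
have {}Es : v%:R = s%:R * pi ^+ 2 - w%:R by rewrite -Es; ring.
have {}Es' : r%:R = s'%:R * pi ^+ 2 - v%:R by rewrite -Es'; ring.
have w3 : w%:R ^+ 3 = 0 :> R by rewrite Wa; transitivity (pi ^+ 3 * a%:R ^+ 3); [ring | exact: pi3z].
have wv : w%:R * v%:R = - w%:R ^+ 2 :> R.
  rewrite Es Wa; transitivity (pi ^+ 3 * (a%:R * s%:R) - (a%:R * pi) ^+ 2); first by ring.
  by rewrite pi3z sub0r.
have w2v : w%:R ^+ 2 * v%:R = 0 :> R by rewrite expr2 -mulrA wv mulrN -exprS w3 oppr0.
split=> //.
  rewrite Es' Es Wa; transitivity (pi ^+ 3 * (a%:R * (s'%:R - s%:R)) + (a%:R * pi) ^+ 2); first by ring.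
  by rewrite pi3z add0r.
split=> //.
- rewrite Es' Es Wa; transitivity (pi ^+ 3 * (2%:R * a%:R * (s'%:R - s%:R) + pi * (s'%:R - s%:R) ^+ 2) + (a%:R * pi) ^+ 2); first by ring.
  by rewrite pi3z add0r.
- have [e E] := inv_predM pv; by rewrite -natrM E natrD natrM pchar_Zp // mul0r addr0.
- have E : 'C(v.+1, 3)%:R * (2%:R * 3%:R) = v.+1%:R * (v%:R * v.-1%:R) :> R.
    rewrite -!natrM; congr (_%:R).
    by have := bin_ffact v.+1 3; rewrite !ffactnS ffactn0 /= muln1.
  transitivity (w%:R ^+ 2 * (h * ('C(v.+1, 3)%:R * (2%:R * 3%:R)))).
    by transitivity (w%:R ^+ 2 * 'C(v.+1, 3)%:R * 3%:R * (h * 2%:R)); [rewrite h2 mulr1 | ring].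
  rewrite E; transitivity (w%:R ^+ 2 * v%:R * (h * v.+1%:R * v.-1%:R)); first by ring.
  by rewrite w2v mul0r.
apply/eqP; rewrite -addr_eq0 -mulrDr binS natrD addrA mulrDr.
rewrite [X in _ + X](_ : _ = 0); last first.
  by rewrite (natr_bin2 h2); transitivity (w%:R ^+ 2 * v%:R * (h * (v%:R - 1))); [ring | rewrite w2v mul0r].
have /dvdnP[b] := dvdn_bin3 pp m0 inv_predDv.
move/(congr1 (fun n => w%:R ^+ 2 * n%:R : R)); rewrite bin3D [in RHS]natrM -/pi mulrCA.
rewrite [in RHS](_ : w%:R ^+ 2 * pi = 0) ?mulr0 => [Eb|]; last first.
  by rewrite Wa; transitivity (pi ^+ 3 * (a%:R ^+ 2)); [ring | exact: pi3z].
rewrite addr0 -[X in _ == X]Eb; apply/eqP.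
transitivity (w%:R ^+ 2 * ('C(w, 3)%:R + 'C(v, 3)%:R) + w%:R ^+ 2 * v%:R * 'C(w, 2)%:R + w%:R ^+ 3 * 'C(v, 2)%:R : R).
  by rewrite w2v w3 !mul0r !addr0.
by ring.
Qed.

Lemma Zp2m_identities : [/\ w%:R ^+ 2 = 0 :> S, v%:R = - w%:R :> S, w.+1%:R * u.+1%:R = 1 :> S &
  (uphalf M2)%:R * 2%:R = 1 :> S].
Proof.
split.
- have /dvdnP[a ->] := inv_pred_dvd pu; rewrite -natrX natrZ_dvd //.
  by rewrite expnMn -expnM [(m * 2)%N]mulnC dvdn_mull.
- by apply/eqP; rewrite -addr_eq0 -natrD addnC natrZ_dvd // inv_predDv.
- have [e E] := inv_predM pu; rewrite -natrM E natrD [(M3 * e)%:R]natrZ_dvd ?addr0 //.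
  by rewrite dvdn_mulr // dvdn_exp2l // leq_mul2r orbT.
by apply: Zp_half; rewrite // oddX op orbT.
Qed.

Lemma periodic_modn (T : Type) (f : nat -> T) N : (forall i, f (i + N)%N = f i) ->
  forall i, f (i %% N)%N = f i.
Proof.
move=> fN i; rewrite [in RHS](divn_eq i N) addnC; elim: (i %/ N)%N => [|k IH].
  by rewrite mul0n addn0.
by rewrite mulSnr addnA fN.
Qed.

(** Hence [i]_q - i modulo p^(3m) depends only on i modulo p^(2m). With the next two periodicities,
    this lets [actC] and [actB] be computed on arbitrary representatives of the coordinates. *)
Lemma brk_modR i : (brk w.+1 (i + M2))%:R = (brk w.+1 i)%:R + M2%:R :> R.
Proof.
have pw := inv_pred_dvd pu; have [c E] := brk_pow_dvd op m0 pw (dvdnn (p ^ (2 * m))).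
rewrite brkD E natrD; congr (_ + _); rewrite brk_geo.
have M3E : (p ^ (m + 2 * m))%N = M3 by rewrite /M3 -[3%N]/(1 + 2)%N mulnDl mul1n.
have EM : (p ^ (2 * m) + p ^ (m + 2 * m) * c)%:R = M2%:R :> R.
  by rewrite natrD [(_ * c)%:R]natrZ_dvd ?addr0 // M3E dvdn_mulr.
rewrite natrM EM natrD natrM.
have [a /(congr1 (fun n => n%:R : R))] := dvdnP pw; rewrite natrM => ->.
have E0 : (p ^ m)%:R * M2%:R = 0 :> R by rewrite -natrM -expnD natrZ_dvd ?M3E.
by transitivity (M2%:R + a%:R * (brk w.+1 i)%:R * ((p ^ m)%:R * M2%:R) : R); [ring | rewrite E0 mulr0 addr0].
Qed.

Lemma dvd_mul_M2 t i : (p ^ m %| t)%N -> t%:R * (i + M2)%:R = t%:R * i%:R :> R.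
Proof.
move=> pt; rewrite -natrM mulnDr natrD [(t * M2)%:R]natrZ_dvd ?addr0 ?natrM //.
by rewrite /M3 -[3%N]/(1 + 2)%N mulnDl mul1n expnD dvdn_mul.
Qed.

Lemma expr_M2 k : r.+1%:R ^+ (k + M2) = r.+1%:R ^+ k :> R.
Proof.
have pr := inv_pred_dvd pv; have [c E] := brk_pow_dvd op m0 pr (dvdnn (p ^ (2 * m))).
have D : (M3 %| r * brk r.+1 M2)%N.
  rewrite E expnD; case/dvdnP: pr => a ->; apply/dvdnP; exists (a * (1 + p ^ m * c))%N.
  by rewrite /M3 -[3%N]/(1 + 2)%N mulnDl mul1n expnD /M2; ring.
by rewrite exprD -[in X in _ * X]natrX brk_geo natrD (natrZ_dvd _ D) // addr0 mulr1.
Qed.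

(* (i, k, d) stands for the normal form x^i c^k y^j with d = i - j, which is
   well defined once x^(p^2m) y^(p^2m) = 1.  The maps actA, actC and actB are the
   left multiplications by x, c and y^-1. *)
Definition Omega : finType := (S * S * R)%type.

Definition pt (i k : nat) (d : R) : Omega := (i%:R, k%:R, d).

Lemma ptE (z : Omega) : z = pt (val z.1.1) (val z.1.2) z.2.
Proof. by case: z => [[i k] d]; rewrite /pt !natr_Zp. Qed.

Definition actA (z : Omega) : Omega := (z.1.1 + 1, z.1.2, z.2 + 1).

Definition actC (z : Omega) : Omega :=
  (w.+1%:R * z.1.1, z.1.2 + 1, z.2 + w%:R * (val z.1.1)%:R).

Definition actB (z : Omega) : Omega :=
  ((brk w.+1 (val z.1.1))%:R, z.1.1 + z.1.2,
   z.2 + ((brk w.+1 (val z.1.1))%:R - (val z.1.1)%:R) + r.+1%:R ^+ val z.1.2).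

Lemma actA_pt i k d : actA (pt i k d) = pt i.+1 k (d + 1).
Proof. by rewrite /actA /pt /= natr1. Qed.

Lemma actC_pt i k d : actC (pt i k d) = pt (w.+1 * i) k.+1 (d + w%:R * i%:R).
Proof.
rewrite /actC /pt [val _]val_Zp_nat //= natrM natr1; congr (_, _, _ + _).
apply: (periodic_modn (f := fun i => w%:R * i%:R)) => j.
exact/dvd_mul_M2/inv_pred_dvd.
Qed.

Lemma actB_pt i k d : actB (pt i k d) =
  pt (brk w.+1 i) (i + k) (d + ((brk w.+1 i)%:R - i%:R) + r.+1%:R ^+ k).
Proof.
rewrite /actB /pt ![val _]val_Zp_nat // natrD; congr (_, _, _ + _ + _).
- have [w2 _ _ hS] := Zp2m_identities.
  have brkS j : (brk w.+1 j)%:R = j%:R + (uphalf M2)%:R * (j%:R * (j%:R - 1)) * w%:R :> S.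
    by rewrite (natr_brk hS) ?w2 ?mulr0 ?addr0 // exprS w2 mulr0.
  by rewrite !brkS Zp_nat_mod.
- apply: (periodic_modn (f := fun i => (brk w.+1 i)%:R - i%:R)) => j.
  by rewrite brk_modR natrD; ring.
exact: (periodic_modn (f := fun k => r.+1%:R ^+ k)) expr_M2 _.
Qed.

Lemma actA_inj : injective actA.
Proof.
case=> [[i k] d] [[i' k'] d'] E.
have Ei : i = i' by exact: addIr _ (congr1 (fun t => t.1.1) E).
have Ek : k = k' by exact: (congr1 (fun t => t.1.2) E).
have Ed : d = d' by exact: addIr _ (congr1 snd E).
by rewrite Ei Ek Ed.
Qed.

Lemma actC_inj : injective actC.
Proof.
have [_ _ qu _] := Zp2m_identities.
case=> [[i k] d] [[i' k'] d'] E; have Ei : w.+1%:R * i = w.+1%:R * i' := congr1 (fun t => t.1.1) E.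
have Ek : k = k' by exact: addIr _ (congr1 (fun t => t.1.2) E).
have := congr1 snd E; rewrite /= {}Ek.
have -> : i = i' by rewrite -[i]mul1r -[i']mul1r -qu [_ * u.+1%:R]mulrC -!mulrA Ei.
by move=> /(addIr _) Ed; congr (_, _, _).
Qed.

Lemma natr_brk_S i : (brk w.+1 i)%:R =
  i%:R + (uphalf M2)%:R * (i%:R * (i%:R - 1)) * w%:R :> S.
Proof.
have [w2 _ _ hS] := Zp2m_identities.
by rewrite (natr_brk hS) ?w2 ?mulr0 ?addr0 // exprS w2 mulr0.
Qed.

Lemma actB_inj : injective actB.
Proof.
case=> [[i k] d] [[i' k'] d'] E; have := congr1 (fun t => t.1.1) E.
have := congr1 (fun t => t.1.2) E; have := congr1 snd E; rewrite /=.
rewrite !natr_brk_S !natr_Zp; set h := (uphalf M2)%:R => Ed Ek Ei.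
have {}Ei : i = i'.
  have [w2 _ _ _] := Zp2m_identities; apply/eqP; rewrite -subr_eq0; apply/eqP.
  set t := h * (i + i' - 1).
  (* The two images differ by (1 + t w) (i - i'), and 1 - t w inverts 1 + t w because w^2 = 0. *)
  transitivity ((1 - t * w%:R) * ((i + h * (i * (i - 1)) * w%:R) - (i' + h * (i' * (i' - 1)) * w%:R)) + w%:R ^+ 2 * (t ^+ 2 * (i - i'))).
    by rewrite /t; ring.
  by rewrite Ei subrr w2 mulr0 mul0r addr0.
move: Ek Ed; rewrite {}Ei => /(addrI _) Ek; rewrite {}Ek => /(addIr _)/(addIr _) Ed.
by congr (_, _, _).
Qed.

Lemma iter_actA n i k d : iter n actA (pt i k d) = pt (i + n) k (d + n%:R).
Proof.
elim: n => [|n IH]; first by rewrite addn0 addr0.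
by rewrite iterS IH actA_pt addnS -addrA natr1.
Qed.

Lemma iter_actC n k d : iter n actC (pt 0 k d) = pt 0 (k + n) d.
Proof.
elim: n => [|n IH]; first by rewrite addn0.
by rewrite iterS IH actC_pt addnS muln0 mulr0 addr0.
Qed.

Lemma iter_actB n i k d : iter n actB (pt i k d) =
  pt (iter_brk w n i) (k + sum_brk w n i)
     (d + ((iter_brk w n i)%:R - i%:R) + r.+1%:R ^+ k * \sum_(t < n) r.+1%:R ^+ sum_brk w t i).
Proof.
elim: n => [|n IH].
  by rewrite /sum_brk !big_ord0 /iter_brk /= addn0 subrr mulr0 !addr0.
rewrite iterS IH actB_pt -iter_brkS.
rewrite (_ : iter_brk w n i + _ = k + sum_brk w n.+1 i)%N; last by rewrite sum_brkS; ring.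
by congr (pt _ _ _); rewrite big_ord_recr /= exprD; ring.
Qed.

Lemma iter_actB0 n d : iter n actB (pt 0 0 d) = pt 0 0 (d + n%:R).
Proof.
elim: n => [|n IH]; first by rewrite addr0.
by rewrite iterS IH actB_pt brk0 subrr addr0 -addrA expr0 natr1.
Qed.

(** The relation x c y^-1 = y^-1 x, that is c = [x, y]; it reduces to [i+1]_q = 1 + q [i]_q. *)
Lemma act_commg z : actA (actC (actB z)) = actB (actA z).
Proof.
rewrite (ptE z); set i := val _; set k := val _; set d := z.2.
rewrite actB_pt actC_pt !actA_pt actB_pt brkSl add1n addSn; congr (pt _ _ _).
ring.
Qed.

Lemma pt_eq i i' k k' d d' : i%:R = i'%:R :> S -> k%:R = k'%:R :> S -> d = d' ->
  pt i k d = pt i' k' d'.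
Proof. by rewrite /pt => -> -> ->. Qed.

(** The relation x c = c x^a, which reduces to q a = 1. *)
Lemma act_conjA z : actA (actC z) = actC (iter u.+1 actA z).
Proof.
have [_ _ qu _] := Zp2m_identities.
rewrite (ptE z); set i := val _; set k := val _; set d := z.2.
rewrite actC_pt actA_pt iter_actA actC_pt; apply: pt_eq => //.
  by transitivity (w.+1%:R * i%:R + w.+1%:R * u.+1%:R : S); [rewrite qu; ring | ring].
have [e E] := inv_predM pu.
have quR : w.+1%:R * u.+1%:R = 1 :> R by rewrite -natrM E natrD natrM pchar_Zp // mul0r addr0.
by transitivity (d + w%:R * i%:R + w.+1%:R * u.+1%:R : R); [rewrite quR | ring].
Qed.

(** The relation c y^-1 = y^-b c. The first two coordinates need only expansions with w^2 = 0; the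
    last one is the key identity. *)
Lemma act_conjB z : actC (actB z) = iter v.+1 actB (actC z).
Proof.
have [h2 w3 rw [r2 wv rv e3 eE]] := Zp3m_identities.
have [w2 vw _ hS] := Zp2m_identities.
rewrite (ptE z); set i := val _; set k := val _; set d := z.2.
rewrite actB_pt !actC_pt iter_actB; apply: pt_eq.
- rewrite (natr_iter_brk2 hS w2) natrM natr_brk_S natrM -!natr1 vw.
  set h := (uphalf M2)%:R.
  transitivity ((1 + w%:R) * i%:R + w%:R * (h * (i%:R * (i%:R - 1))) + w%:R ^+ 2 * (h * (i%:R * (i%:R - 1))) : S).
    by ring.
  rewrite w2 mul0r -[0](mul0r ((1 - w%:R) * h * (2%:R * i%:R ^+ 2 + w%:R * i%:R ^+ 2 - i%:R) - h * (i%:R * (i%:R - 1)))) -w2.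
  by ring.
- rewrite natrD (natr_sum_brk2 hS w2) (natr_bin2 hS) natrM -!natr1 natrD vw.
  set h := (uphalf M2)%:R.
  transitivity (i%:R + k%:R + 1 + w%:R ^+ 2 * (- i%:R + h ^+ 2 * (1 - w%:R) * (- 1) * ((1 + w%:R) * i%:R) * ((1 + w%:R) * i%:R - 1)) : S).
    by rewrite w2 mul0r addr0.
  by ring.
have := iter_brk_key_identity h2 w3 rw r2 wv rv e3 eE i k; set D := \sum_(t < _) _ => Ek.
transitivity (d + w.+1%:R * (brk w.+1 i)%:R - i%:R + r.+1%:R ^+ k : R); first by ring.
transitivity (d + ((iter_brk w v.+1 (w.+1 * i))%:R + r.+1%:R ^+ k.+1 * D) - i%:R : R).
  by rewrite Ek; ring.
by ring.
Qed.

(** * The permutation group and its orders *)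

Local Open Scope group_scope.

Definition permA : {perm Omega} := perm actA_inj.
Definition permB : {perm Omega} := perm actB_inj.
Definition permC : {perm Omega} := perm actC_inj.

Lemma perm_iterE (f : Omega -> Omega) (fI : injective f) n z : (perm fI ^+ n) z = iter n f z.
Proof. by rewrite permX; elim: n => //= n ->; rewrite permE. Qed.

(* Permutations multiply on the right, so the left action of a generator is
   represented by the inverse permutation; actB is the action of y^-1. *)
Lemma perm_commg : [~ permA^-1, permB] = permC^-1.
Proof.
have E : permB * permC * permA = permA * permB.
  by apply/permP=> z; rewrite !permM !permE act_commg.
have -> : permC = permB^-1 * (permA * permB) * permA^-1.
  by rewrite -E !mulgA mulVg mul1g mulgK.
by rewrite commgEl conjgE !invMg !invgK !mulgA.
Qed.

Lemma perm_Mac : Mac u.+1 v.+1 permA^-1 permB.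
Proof.
split; last first.
  rewrite -invg_comm perm_commg invgK; apply: (mulgI permC); rewrite conjgE mulKVg.
  by apply/permP=> z; rewrite !permM perm_iterE !permE act_conjB.
rewrite perm_commg conjVg expgVn; congr (_^-1); rewrite conjgE invgK.
apply: (mulIg permC); rewrite mulgA mulgKV.
by apply/permP=> z; rewrite !permM perm_iterE !permE act_conjA.
Qed.

Lemma natrS_inj n : n%:R = 0 :> S -> (M2 %| n)%N.
Proof. by move/(congr1 val); rewrite /= val_Zp_nat //; move/eqP. Qed.

Lemma natrR_inj n : n%:R = 0 :> R -> (M3 %| n)%N.
Proof. by move/(congr1 val); rewrite /= val_Zp_nat //; move/eqP. Qed.

Lemma dvdn_order_permA : (M3 %| #[permA^-1])%N.
Proof.
rewrite orderV; apply: natrR_inj.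
have := perm_iterE actA_inj #[permA] (pt 0 0 0).
by rewrite expg_order perm1 iter_actA add0r => /(congr1 snd) /= <-.
Qed.

Lemma dvdn_order_permB : (M3 %| #[permB])%N.
Proof.
apply: natrR_inj; have := perm_iterE actB_inj #[permB] (pt 0 0 0).
by rewrite expg_order perm1 iter_actB0 add0r => /(congr1 snd) /= <-.
Qed.

Lemma dvdn_order_permC : (M2 %| #[[~ permA^-1, permB]])%N.
Proof.
rewrite perm_commg orderV; apply: natrS_inj; have := perm_iterE actC_inj #[permC] (pt 0 0 0).
by rewrite expg_order perm1 iter_actC add0n => /(congr1 (fun t => t.1.2)) /= <-.
Qed.

(** The group is transitive on [Omega], which has p^(2m+2m+3m) points. *)
Lemma dvdn_card_perm : (p ^ (7 * m) %| #|<<[set permA^-1; permB]>>|)%N.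
Proof.
pose G := <<[set permA^-1; permB]>>%G; rewrite -[<<_>>]/(gval G).
have AG : permA \in G by rewrite -groupV mem_gen // !inE eqxx.
have BG : permB \in G by rewrite mem_gen // !inE eqxx orbT.
have CG : permC \in G by rewrite -groupV -perm_commg groupR // groupV.
have cardO : #|Omega| = (p ^ (7 * m))%N.
  rewrite !card_prod !card_ord !Zp_cast // /M2 /M3 -!expnD; congr (_ ^ _)%N; ring.
have <- : #|orbit 'P G (pt 0 0 0)| = (p ^ (7 * m))%N.
  rewrite -cardO; apply: eq_card => z; rewrite [RHS]inE; apply/orbitP.
  set i := val z.1.1; set k := val z.1.2.
  (* From the base point, B first sets the last coordinate to d - i, C then sets k, and A adds i to
     the first and last coordinates. *)
  exists (permB ^+ val (z.2 - i%:R)%R * permC ^+ k * permA ^+ i); first by rewrite !groupM ?groupX.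
  rewrite /= apermE !permM !perm_iterE iter_actB0 iter_actC iter_actA [RHS]ptE.
  by rewrite !add0n add0r (natr_Zp (z.2 - i%:R)%R) subrK.
exact: dvdn_orbit.
Qed.
End PermutationModel.

Local Close Scope ring_scope.

(** * The Sylow subgroup *)

Lemma expgi_modn (gT : finGroupType) (g : gT) (z : int) (M n : nat) :
  #[g] %| M -> (M %| (z - Posz n)%R)%Z -> expgi g z = g ^+ n.
Proof.
move=> oM Mz; have {M oM Mz} : (#[g] %| (z - Posz n)%R)%Z by apply: dvdz_trans Mz; rewrite dvdzE.
case: z => k /= gk.
  apply/eqP; rewrite eq_expg_mod_order.
  by move: gk; rewrite -eqz_mod_dvd !modz_nat.
have gn : #[g] %| n + k.+1 by move: gk; rewrite NegzE dvdzE; rewrite -opprD abszN -PoszD addnC.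
by apply: (mulIg (g ^+ k.+1)); rewrite mulVg -expgD; apply/esym/eqP; rewrite -order_dvdn.
Qed.

Lemma exists_mod_pred (z : int) (M : nat) : 0 < M ->
  exists n : nat, (M %| (z - Posz n.+1)%R)%Z.
Proof.
move=> M0; exists `|((z - 1) %% M)%Z|%N.
have Mn0 : Posz M != 0%R by rewrite -lt0n in M0 *.
rewrite -add1n PoszD gez0_abs ?modz_ge0 // opprD addrA -eqz_mod_dvd modz_mod.
exact: eqxx.
Qed.

Lemma dvdn_mod_pred (z : int) (M n d : nat) : (M %| (z - Posz n.+1)%R)%Z -> d %| M ->
  (d %| n) = (d %| `|(z - 1)%R|).
Proof.
move=> Mz dM; have dz : (d %| (z - Posz n.+1)%R)%Z by apply: dvdz_trans Mz; rewrite dvdzE.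
have -> : (z - 1 = (z - Posz n.+1) + Posz n)%R by rewrite -addn1 PoszD; ring.
by rewrite -[RHS]/(Posz d %| _)%Z -[LHS]/(Posz d %| Posz n)%Z; apply/esym/rpredDl.
Qed.

(** The modulus p^(m+2) is fine enough to see that p^(m+1) does not divide z - 1 and, for p = 3, to
    read z modulo 9. *)
Lemma val_cond_mod (p m n M : nat) (z : int) : prime p -> (z != 1)%R ->
  logn p `|(z - 1)%R| = m -> (p = 3 -> ~~ (z == 7 %[mod 9])%Z) ->
  (M %| (z - Posz n.+1)%R)%Z -> p ^ (m.+2) %| M -> val_cond p m n.
Proof.
move=> pp z1 lz z7 Mz pM.
have z0 : 0 < `|(z - 1)%R| by rewrite absz_gt0 subr_eq0.
have dM k : k <= m.+2 -> p ^ k %| M by move=> km; apply: dvdn_trans pM; apply: dvdn_exp2l.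
have pm : p ^ m %| n by rewrite (dvdn_mod_pred Mz) ?dM ?pfactor_dvdn ?lz // ltnW.
have pmS : ~~ (p ^ m.+1 %| n) by rewrite (dvdn_mod_pred Mz) ?dM ?pfactor_dvdn ?lz ?ltnn.
case/dvdnP: pm => s Es; exists s; first by rewrite mulnC.
split; first by apply: contra pmS => ps; rewrite Es expnS dvdn_mul.
move=> p3; apply: contra (z7 p3) => /eqP n7.
have z9 : (9 %| (z - Posz n.+1)%R)%Z.
  apply: dvdz_trans Mz; rewrite dvdzE /=; apply: dvdn_trans pM.
  by rewrite p3 !expnS mulnA dvdn_mulr.
move: z9; rewrite -eqz_mod_dvd => /eqP->; rewrite !modz_nat; apply/eqP; congr Posz.
exact: n7.
Qed.

Section SylowSubgroup.
Variables (p : nat) (alpha beta : int) (m : nat) (gT : finGroupType) (G : {group gT}) (x y : gT).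
Hypotheses (pp : prime p) (op : odd p) (m0 : 0 < m).
Hypotheses (a1 : (alpha != 1)%R) (b1 : (beta != 1)%R).
Hypotheses (a7 : p = 3 -> ~~ (alpha == 7 %[mod 9])%Z) (b7 : p = 3 -> ~~ (beta == 7 %[mod 9])%Z).
Hypotheses (la : logn p `|(alpha - 1)%R|%N = m) (lb : logn p `|(beta - 1)%R|%N = m).
Hypothesis ab : p ^ (2 * m) %| `|(alpha - beta)%R|%N.

(** The universal property gives a morphism whose image contains the permutation group of the model,
    so the orders bounded there divide those in [G]. *)
Lemma Gab_Mac : is_Gab G alpha beta x y ->
  exists u v, [/\ G :=: <<[set x; y]>>, Mac u.+1 v.+1 x y,
    [/\ val_cond p m u, val_cond p m v & u = v %[mod p ^ (2 * m)]],
    p ^ (7 * m) %| #|G| &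
    [/\ p ^ (3 * m) %| #[x], p ^ (3 * m) %| #[y] & p ^ (2 * m) %| #[[~ x, y]]]].
Proof.
have [m2 m3] : m.+2 <= (3 * m).+2 /\ 2 * m <= (3 * m).+2 by split; lia.
case=> GE [rx ry] univ.
pose rT := {perm Omega p m}.
(* Modulo [M], alpha and beta may be replaced by natural numbers without changing powers in either
   group or the p-adic conditions. *)
pose M := (#|gT| * (#|rT| * p ^ (3 * m).+2))%N.
have p0 := prime_gt0 pp.
have M0 : 0 < M by rewrite muln_gt0 muln_gt0 expn_gt0 p0 andbT -!cardsT !cardG_gt0.
have [u Mu] := exists_mod_pred alpha M0; have [v Mv] := exists_mod_pred beta M0.
have og (g : gT) : #[g] %| M by rewrite dvdn_mulr // -cardsT order_dvdG // inE.
have oh (g : rT) : #[g] %| M by rewrite dvdn_mull // dvdn_mulr // -cardsT order_dvdG // inE.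
have pM k : k <= (3 * m).+2 -> p ^ k %| M.
  by move=> km; rewrite dvdn_mull // dvdn_mull // dvdn_exp2l.
have vu : val_cond p m u by apply: (val_cond_mod pp a1 la a7 Mu); apply: pM.
have vv : val_cond p m v by apply: (val_cond_mod pp b1 lb b7 Mv); apply: pM.
have uv : u = v %[mod p ^ (2 * m)].
  have M2 : p ^ (2 * m) %| M by apply: pM.
  have du : (Posz (p ^ (2 * m))%N %| (alpha - Posz u.+1)%R)%Z by apply: dvdz_trans Mu; rewrite dvdzE.
  have dv : (Posz (p ^ (2 * m))%N %| (beta - Posz v.+1)%R)%Z by apply: dvdz_trans Mv; rewrite dvdzE.
  have ab' : (Posz (p ^ (2 * m))%N %| (alpha - beta)%R)%Z by rewrite dvdzE.
  have : (Posz (p ^ (2 * m))%N %| (Posz u - Posz v)%R)%Z.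
    have -> : (Posz u - Posz v = (alpha - beta) - (alpha - Posz u.+1) + (beta - Posz v.+1))%R.
      by rewrite -[u.+1]addn1 -[v.+1]addn1 !PoszD; ring.
    exact: rpredD (rpredB ab' du) dv.
  by rewrite -eqz_mod_dvd !modz_nat => /eqP[].
have [s Eu _] := vu; have [t Ev _] := vv.
have pu : p ^ m %| u by rewrite Eu dvdn_mulr.
have pv : p ^ m %| v by rewrite Ev dvdn_mulr.
pose X := (permA p m)^-1; pose Y : rT := permB op pp m0 pu uv.
have MXY : Mac u.+1 v.+1 X Y := perm_Mac op pp m0 pu pv uv.
have [f [fx fy]] : exists f : {morphism G >-> rT}, f x = X /\ f y = Y.
  by apply: univ; split; rewrite (expgi_modn (oh _) Mu, expgi_modn (oh _) Mv); case: MXY.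
have xG : x \in G by rewrite GE mem_gen // !inE eqxx.
have yG : y \in G by rewrite GE mem_gen // !inE eqxx orbT.
exists u, v; split=> //.
- by rewrite GE.
- by split; rewrite -?(expgi_modn (og _) Mu) -?(expgi_modn (og _) Mv).
- apply: dvdn_trans (dvdn_morphim f G); apply: dvdn_trans (dvdn_card_perm op pp m0 pu pv uv) _.
  apply: cardSg; rewrite gen_subG -/X -/Y -fx -fy.
  by apply/subsetP=> _ /set2P[]->; apply: mem_morphim.
have oXx g : g \in G -> #[f g] %| #[g] by apply: morph_order.
split.
- by apply: dvdn_trans (oXx _ xG); rewrite fx; apply: dvdn_order_permA.
- by apply: dvdn_trans (oXx _ yG); rewrite fy; exact: dvdn_order_permB pv uv.
by apply: dvdn_trans (oXx _ (groupR xG yG)); rewrite morphR // fx fy; exact: dvdn_order_permC pv uv.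
Qed.

Lemma Gab_Sylow (P : {group gT}) : is_Gab G alpha beta x y -> P \in 'Syl_p(G) ->
    [/\ #|P| = (p ^ (7 * m))%N, nil_class P = 5%N,
        #[x.`_p] = (p ^ (3 * m))%N, #[y.`_p] = (p ^ (3 * m))%N &
        #[([~ x, y]).`_p] = (p ^ (2 * m))%N].
Proof.
move=> /Gab_Mac[u [v [GE Mxy [vu vv uv] oG [ox oy oc]]]]; rewrite inE => sP.
have [nH hH] := Mac_constt_Sylow p Mxy; rewrite -GE in nH hH.
(* The Hall subgroup generated by the p-parts is normal, so it is the only Sylow p-subgroup. *)
have PE : P :=: <<[set x.`_p; y.`_p]>>.
  apply/eqP; rewrite eqEcard (card_Hall hH) (card_Hall sP) leqnn andbT.
  by rewrite (sub_normal_Hall hH nH (pHall_sub sP)) (pHall_pgroup sP).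
have cE := Mac_constt_commg p Mxy.
have H : pMac p m u v x.`_p y.`_p.
  by split=> //; [exact: Mac_constt | exact: p_elt_constt | exact: p_elt_constt | rewrite cE p_elt_constt].
have ppk k : p.-nat (p ^ k)%N by rewrite pnatX pnat_id.
have oE (g : gT) k : p ^ k %| #[g] -> g.`_p ^+ (p ^ k) = 1 -> #[g.`_p] = (p ^ k)%N.
  move=> kg /eqP; rewrite -order_dvdn => gk; apply/eqP; rewrite eqn_dvd gk order_constt /=.
  by rewrite -[X in X %| _](part_pnat_id (ppk _)) partn_dvd.
have oxp := oE _ _ ox (pMac_x3 H).
split=> //; last 1 first.
- by apply: oE => //; rewrite -cE; apply: pMac_c2 H.
- apply/eqP; rewrite eqn_leq [X in X && _](_ : _ = true) /=; last first.
    by rewrite PE; apply: (pMac_card_le H).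
  rewrite (card_Hall sP) dvdn_leq ?part_gt0 //.
  by rewrite -[X in X %| _](part_pnat_id (ppk _)) partn_dvd // cardG_gt0.
- apply/eqP; rewrite eqn_leq; apply/andP; split; rewrite PE.
    exact: pMac_nil_class_le5 H.
  exact: pMac_nil_class_ge5 H oxp.
exact: oE oy (pMac_y3 H).
Qed.
End SylowSubgroup.

Theorem theorem8p1 (p : nat) (alpha beta : int) (m : nat)
    (gT : finGroupType) (G : {group gT}) (x y : gT) :
  prime p ->
  alpha != 1%R -> beta != 1%R ->
  (3 < p)%N \/
    (p = 3 /\ ~~ (alpha == 7 %[mod 9])%Z /\ ~~ (beta == 7 %[mod 9])%Z) ->
  logn p `|(alpha - 1)%R|%N = m -> logn p `|(beta - 1)%R|%N = m -> (0 < m)%N ->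
  (alpha = beta \/ (2 * m <= logn p `|(alpha - beta)%R|%N)%N) ->
  is_Gab G alpha beta x y ->
  forall P : {group gT}, P \in 'Syl_p(G) ->
    [/\ #|P| = (p ^ (7 * m))%N, nil_class P = 5%N,
        #[x.`_p] = (p ^ (3 * m))%N, #[y.`_p] = (p ^ (3 * m))%N &
        #[([~ x, y]).`_p] = (p ^ (2 * m))%N].

Proof.
move=> pp a1 b1 p3 la lb m0 ab HG P sP.
have op : odd p.
  by case: (even_prime pp) => // p2; move: p3; rewrite p2 => -[|[]].
have p7 : p = 3 -> ~~ (alpha == 7 %[mod 9])%Z /\ ~~ (beta == 7 %[mod 9])%Z.
  by move=> E; case: p3 => [|[]//]; rewrite E.
have dab : (p ^ (2 * m) %| `|(alpha - beta)%R|)%N.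
  (* The case alpha = beta is separate because [logn p 0] is 0, not infinite. *)
  have [->|nab] := eqVneq alpha beta; first by rewrite subrr dvdn0.
  case: ab => [E|]; first by rewrite E eqxx in nab.
  by rewrite pfactor_dvdn // absz_gt0 subr_eq0.
apply: (Gab_Sylow (alpha := alpha) (beta := beta) pp op m0 a1 b1 _ _ la lb dab HG sP).
  by case/p7.
by case/p7.
Qed.
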